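(* Let $d\ge1$, $\upsilon>0$, and consider the Cole-Hopf transformation based MRT-LB model on the D$d$Q$(1+2d^2)$ lattice for the $d$-dimensional coupled Burgers' equations at the diffusive scaling $\Delta t=\eta\Delta x^2$ ($\eta>0$ fixed), as specified in the context. Put $\xi=\frac1{s_1}-\frac12$ and $\varepsilon=\upsilon\Delta t/\Delta x^2$. (i) The model is fourth-order accurate in space (in the sense defined in the context) once the weight coefficients and relaxation parameters satisfy for $d=1$: $\;\varepsilon=2w_1\xi,\quad R_1=0,\quad \mathrm{Con}_1=0$; for $d>1$: $\;\varepsilon=[2w_1+4(d-1)w_{1+2d}]\xi,\quad R_{d1}=0,\quad R_{d2}=0,\quad \mathrm{Con}_{d1}=0,\quad\mathrm{Con}_{d2}=0$, where $$R_1=6[s_2(s_1-1)+s_1^2+s_2-2s_1]-s_2s_1^2+6w_1[2s_1(2-s_1)+s_2(4+s_1^2-6s_1)],$$ $$\mathrm{Con}_1=3s_1[s_2+s_1-2]-s_1^2s_2+6w_1(2-s_1)[s_1+s_2(1-s_1)],$$ $$R_{d1}=6[s_{21}(s_1-1)+s_1^2+s_{21}-2s_1]-s_{21}s_1^2+6[w_1+2(d-1)w_{1+2d}]\,[2s_1(2-s_1)+s_{21}(4+s_1^2-6s_1)],$$ $$\begin{aligned}R_{d2}={}&s_1^2w_{1+2d}\big[2(s_1-2)(2s_{21}+s_{22})+s_{21}s_{22}(8-3s_1)\big]-8s_1s_{21}s_{22}\big(w_1+2(d-1)w_{1+2d}\big)^2\\&+s_{22}\Big(w_1^2+4(d-1)w_{1+2d}[w_1+(d-1)w_{1+2d}]\Big)\Big(8\big[s_1+s_{21}-s_1^2+(s_1-1)s_1s_{21}\big]+(2-s_{21})s_1^3\Big),\end{aligned}$$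 $$\mathrm{Con}_{d1}=3s_1[s_{21}+s_1-2]-s_1^2s_{21}+6[w_1+2(d-1)w_{1+2d}](2-s_1)[s_1+s_{21}(1-s_1)],$$ $$\begin{aligned}\mathrm{Con}_{d2}={}&-\Big(s_{22}w_1^2+4s_{22}[w_1+(d-1)w_{1+2d}]w_{1+2d}(d-1)\Big)(s_1-2)(s_1+s_{21}-s_1s_{21})\\&-s_1^2w_{1+2d}(2s_{21}+s_{22}-2s_{21}s_{22}).\end{aligned}$$ (ii) For every $\varepsilon>0$ these systems are solved by the following weights and relaxation parameters: for $d=1$: $\;s_1=\dfrac{2}{6\varepsilon+1},\quad s_2=\dfrac{24\varepsilon}{(6\varepsilon+1)^2},\quad w_1=\dfrac16$; for $d>1$: $\;s_1=\dfrac{2}{6\varepsilon+1},\quad s_{21}=\dfrac{24\varepsilon}{(6\varepsilon+1)^2},\quad s_{22}=\dfrac{4}{6\varepsilon+3},\quad w_1=\dfrac16-\dfrac{(d-1)\varepsilon}{3},\quad w_{1+2d}=\dfrac{\varepsilon}{6}$. (iii) In addition, the gradient of the solution of the diffusion equation $\partial_t\theta=\upsilon\nabla^2\theta$ can be calculated locally from the non-equilibrium distribution function with fourth-order accuracy in space: $$\nabla\theta=-\frac{s_1}{\Delta t\,c_s^2}\sum_kc_k(f_k-f_k^{eq})+O(\Delta x^4).$$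
   Context: **Equations.** The $d$-dimensional coupled Burgers' equations are $\partial_tu+u\cdot\nabla u=\upsilon\nabla^2u$ for $u=(u_1,\dots,u_d)$, with the potential symmetry condition $\nabla u=(\nabla u)^T$ and viscosity $\upsilon>0$. The Cole-Hopf transformation $u=-2\upsilon\,\nabla\theta/\theta$ reduces them to the diffusion equation $\partial_t\theta=\upsilon\nabla^2\theta$. **Lattice.** $\Delta x,\Delta t$ are the lattice spacing and time step and $c=\Delta x/\Delta t$. The discrete velocities are $c_k=c\,e_k$, where the $e_k$ run over the $q=1+2d^2$ vectors of $\mathbb Z^d$: $0$; $\pm\mathbf e_j$ ($1\le j\le d$); $\pm\mathbf e_j\pm\mathbf e_l$ ($1\le j<l\le d$), all four sign choices ($\mathbf e_j$ are the standard basis vectors). For $d=1$ these are $0,1,-1$. $c_{ki}$ is the $i$-th component of $c_k$. **Moments and relaxation.** $M$ is the $q\times q$ matrix whose rows are the following functions of the discrete velocity $c_k=(c_{k1},\dots,c_{kd})$, evaluated at all $k$: $1$; $c_{kj}$ ($d$ rows); $c_{kj}^2$ ($d$ rows); and for $j<l$: $c_{kj}c_{kl}$; $c_{kj}c_{kl}^2$; $c_{kj}^2c_{kl}$; $c_{kj}^2c_{kl}^2$ ($d(d-1)/2$ rows of each type). $S$ is diagonal. For $d=1$, $S=\mathrm{diag}(s_0,s_1,s_2)$. For $d>1$ its entries are $s_0$ for the row $1$, $s_1$ for the rows $c_{kj}$, $s_{21}$ for the rows $c_{kj}^2$, $s_{22}$ for the rows $c_{kj}c_{kl}$, and $1$ for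 all remaining rows. The relaxation parameters $s_0,s_1,s_2,s_{21},s_{22}$ lie in $(0,2)$. Put $\Lambda=M^{-1}SM$. **Model.** $f_i(x+c_i\Delta t,t+\Delta t)=f_i(x,t)-\sum_k\Lambda_{ik}\,[f_k-f_k^{eq}](x,t)$, with $\theta=\sum_if_i$ and $f_i^{eq}=(\text{weight of }c_i)\,\theta$. The weight is $w_1$ for every $\pm c\,\mathbf e_j$, $w_{1+2d}$ for every $c(\pm\mathbf e_j\pm\mathbf e_l)$, and $w_0=1-2dw_1-2d(d-1)w_{1+2d}$ for the zero velocity (for $d=1$ only $w_0,w_1$ occur). Then $\sum_if_i^{eq}=\theta$, $\sum_ic_if_i^{eq}=0$, $\sum_ic_ic_i^Tf_i^{eq}=c_s^2\theta I$ with $c_s^2=[2w_1+4(d-1)w_{1+2d}]c^2$. The velocity is computed by $$u_i=(2-s_1)\frac{\sum_kc_{ki}(f_k-f_k^{eq})}{\sum_kf_k},\qquad i=1,\dots,d.$$ **Formal meaning (Maxwell iteration).** Weights, relaxation parameters and $\eta$ are fixed as $\Delta x\to0$, and $\theta$ is smooth. Let $D=\mathrm{diag}(\partial_t+c_k\cdot\nabla)_k$. By Taylor expansion the model reads $e^{\Delta tD}f=f-\Lambda(f-f^{eq})$, and $f$ is understood as the formal solution $$f=\sum_{n\ge0}\Big[-\Lambda^{-1}\big(e^{\Delta tD}-I\big)\Big]^nf^{eq},$$ expanded in powers of $\Delta x$ using $\Delta t\,\partial_t=\eta\Delta x^2\partial_t$ and $\Delta t\,c_k\cdot\nabla=\Delta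 x\,e_k\cdot\nabla$. The modified equation of the model is the equation for $\theta$ obtained by summing all components of this identity, i.e. from $\sum_if_i=\theta$ (equivalently $\sum_i[(e^{\Delta tD}-I)f]_i=0$), dividing by $\Delta t$, and eliminating the higher-order and mixed time derivatives of $\theta$ by means of the lower-order modified equation, so that it takes the form $\partial_t\theta=\big(\tfrac1{s_1}-\tfrac12\big)c_s^2\Delta t\,\nabla^2\theta+\Delta x^2(\text{fourth-order spatial derivatives of }\theta)+O(\Delta x^4)$. $O(\Delta x^p)$ is understood in the sense of these formal expansions. **Fourth-order accuracy in space** of the model means that (a) its modified equation is $\partial_t\theta=\upsilon\nabla^2\theta+O(\Delta x^4)$, and (b) the velocity formula above satisfies $(2-s_1)\sum_kc_{ki}(f_k-f_k^{eq})\big/\sum_kf_k=-2\upsilon\,\partial_{x_i}\theta/\theta+O(\Delta x^4)$ for $i=1,\dots,d$. *)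

(* Defs.v *)
From mathcomp Require Import all_boot all_order all_algebra.
From mathcomp Require Import all_classical all_reals all_analysis.

Set Implicit Arguments.
Unset Strict Implicit.
Unset Printing Implicit Defensive.

Import Order.TTheory GRing.Theory Num.Theory.
Import numFieldNormedType.Exports.

Local Open Scope ring_scope.

Definition nvel (d : nat) : nat := (1 + 2 * d ^ 2)%N.

Definition pairs (d : nat) : seq ('I_d * 'I_d) :=
  [seq p : 'I_d * 'I_d <- enum {: 'I_d * 'I_d} | (p.1 < p.2)%N].

Definition unitv (R : realType) (d : nat) (j : 'I_d) : 'rV[R]_d := delta_mx 0 j.

Definition velset (R : realType) (d : nat) : seq 'rV[R]_d :=
  0 :: [seq s *: unitv R j | j <- enum 'I_d, s <- [:: 1; -1]]
    ++ [seq s.1 *: unitv R p.1 + s.2 *: unitv R p.2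
         | p <- pairs d, s <- [:: (1, 1); (1, -1); (-1, 1); (-1, -1)]].

Definition evec (R : realType) (d : nat) (k : 'I_(nvel d)) : 'rV[R]_d :=
  nth 0 (velset R d) k.

(** [wax] is the weight w_1 of the velocities c (+-e_j), [wdiag] the weight
    w_(1+2d) of the velocities c (+-e_j +- e_l).  For d = 1 there are no diagonal
    velocities and no mixed moments: [wdiag] and [s22] then occur nowhere in the
    model, and [s21] is the parameter called s_2. *)
Record params (R : realType) := Params {
  wax : R; wdiag : R; s0 : R; s1 : R; s21 : R; s22 : R }.

Definition admissible (R : realType) (d : nat) (P : params R) : Prop :=
  [/\ 0 < s0 P < 2, 0 < s1 P < 2, 0 < s21 P < 2
    & (1 < d)%N -> 0 < s22 P < 2].

Definition wzero (R : realType) (d : nat) (P : params R) : R :=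
  1 - 2 * d%:R * wax P - 2 * d%:R * (d%:R - 1) * wdiag P.

(** In the enumeration [velset], index 0 is the zero velocity, the indices
    1..2d are the axis velocities, and the diagonal velocities start at 1+2d. *)
Definition weight (R : realType) (d : nat) (P : params R) (k : 'I_(nvel d)) : R :=
  if k == 0 :> nat then wzero d P
  else if (k <= 2 * d)%N then wax P else wdiag P.

(** The rows of M, each paired with its diagonal entry in S. *)
Definition moments (R : realType) (d : nat) (P : params R) :
    seq (('rV[R]_d -> R) * R) :=
  (fun=> 1, s0 P)
  :: [seq (fun v : 'rV[R]_d => v 0 j, s1 P) | j <- enum 'I_d]
  ++ [seq (fun v : 'rV[R]_d => v 0 j ^+ 2, s21 P) | j <- enum 'I_d]
  ++ [seq (fun v : 'rV[R]_d => v 0 p.1 * v 0 p.2, s22 P) | p <- pairs d]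
  ++ [seq (fun v : 'rV[R]_d => v 0 p.1 * v 0 p.2 ^+ 2, 1) | p <- pairs d]
  ++ [seq (fun v : 'rV[R]_d => v 0 p.1 ^+ 2 * v 0 p.2, 1) | p <- pairs d]
  ++ [seq (fun v : 'rV[R]_d => v 0 p.1 ^+ 2 * v 0 p.2 ^+ 2, 1) | p <- pairs d].

Definition moment (R : realType) (d : nat) (P : params R) (a : 'I_(nvel d)) :
    ('rV[R]_d -> R) * R :=
  nth (fun=> 0, 0) (moments d P) a.

(** The two enumerations have exactly 1 + 2 d^2 elements, so the default values
    of [nth] above are never used. *)
Lemma size_pairs (d : nat) : (2 * size (pairs d) + d = d ^ 2)%N.
Proof.
pose up (p : 'I_d * 'I_d) := (p.1 < p.2)%N.
pose sw (p : 'I_d * 'I_d) := (p.2, p.1).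
have swK : involutive sw by case.
have hup : size (pairs d) = (\sum_p up p)%N.
  rewrite /pairs size_filter -sum1_count big_enum_cond /= big_mkcond /=.
  by apply: eq_bigr => p _; rewrite /up; case: ifP.
have hdn : (\sum_p up p = \sum_p up (sw p))%N.
  exact: (reindex_inj (inv_inj swK)).
have hdg : d = (\sum_(p : 'I_d * 'I_d) (p.1 == p.2))%N.
  rewrite -(pair_big xpredT xpredT (fun i j : 'I_d => nat_of_bool (i == j))) /=.
  rewrite (eq_bigr (fun=> 1%N)) ?sum1_card ?card_ord // => i _.
  rewrite (bigD1 i) //= eqxx big1 // => j; rewrite eq_sym.
  by case: eqP.
have -> : (d ^ 2 = \sum_(p : 'I_d * 'I_d) 1)%N by rewrite sum1_card card_prod card_ord mulnn.
rewrite [X in (_ + X)%N]hdg.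
rewrite mul2n -addnn hup {2}hdn -!big_split /=.
by apply: eq_bigr => -[i j] _; rewrite /up /= -val_eqE /=; case: ltngtP.
Qed.
Lemma size_velset (R : realType) (d : nat) : size (velset R d) = nvel d.
Proof.
rewrite /velset -cat1s !size_cat !size_allpairs size_enum_ord /nvel -size_pairs /=.
by rewrite mulnDr mulnA [(2 * d)%N]mulnC [(size _ * _)%N]mulnC [(d * 2 + _)%N]addnC.
Qed.

Lemma size_moments (R : realType) (d : nat) (P : params R) :
  size (moments d P) = nvel d.
Proof.
rewrite /= !size_cat !size_map -!enumT !size_enum_ord /nvel -size_pairs.
by rewrite add1n addnA addnC mulnDr !mul2n -!addnn -!addnA.
Qed.

(** With c = dx/dt the rows of M are homogeneous in c and S is diagonal, so that
    Lambda does not depend on the numerical value of c <> 0.  This is what makes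
    it a constant matrix in the expansions in powers of dx below. *)
Definition Mmx (R : realType) (d : nat) (P : params R) (c : R) : 'M[R]_(nvel d) :=
  \matrix_(a, k) (moment P a).1 (c *: evec R k).

Definition Smx (R : realType) (d : nat) (P : params R) : 'M[R]_(nvel d) :=
  diag_mx (\row_a (moment P a).2).

Definition Lambda (R : realType) (d : nat) (P : params R) (c : R) :
    'M[R]_(nvel d) :=
  invmx (Mmx d P c) *m Smx d P *m Mmx d P c.

Definition field (R : realType) (d : nat) : Type := 'rV[R]_d * R -> R.

Definition partial_x (R : realType) (d : nat) (j : 'I_d) (u : field R d) :
    field R d :=
  fun z => derive (u : 'rV[R]_d * R -> R) z (unitv R j, 0).

Definition partial_t (R : realType) (d : nat) (u : field R d) : field R d :=
  fun z => derive (u : 'rV[R]_d * R -> R) z (0, 1).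

Definition laplacian (R : realType) (d : nat) (u : field R d) : field R d :=
  fun z => \sum_(j < d) partial_x j (partial_x j u) z.

(** [None] is the time direction. *)
Definition axis (R : realType) (d : nat) (a : option 'I_d) : 'rV[R]_d * R :=
  if a is Some j then (unitv R j, 0) else (0, 1).

Definition iter_partial (R : realType) (d : nat) (s : seq (option 'I_d))
    (u : field R d) : field R d :=
  foldr (fun a v z => derive (v : 'rV[R]_d * R -> R) z (axis R a)) u s.

Definition smooth (R : realType) (d : nat) (u : field R d) : Prop :=
  forall s : seq (option 'I_d),
    continuous (iter_partial s u : 'rV[R]_d * R -> R) /\
    forall a z, derivable (iter_partial s u : 'rV[R]_d * R -> R) z (axis R a).

(** [F : dxseries R d] stands for the formal series \sum_n (F n) dx^n. *)

Definition dxseries (R : realType) (d : nat) : Type := nat -> field R d.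

Definition smooth_series (R : realType) (d : nat) (F : dxseries R d) : Prop :=
  forall n, smooth (F n).

Definition const_series (R : realType) (d : nat) (u : field R d) : dxseries R d :=
  fun n => if n is 0%N then u else fun=> 0.

Definition mul_dx (R : realType) (d : nat) (F : dxseries R d) : dxseries R d :=
  fun n => if n is m.+1 then F m else fun=> 0.

(** F = G + O(dx^p) at the point [z]. *)
Definition eq_upto (R : realType) (d p : nat) (F G : dxseries R d)
    (z : 'rV[R]_d * R) : Prop :=
  forall n, (n < p)%N -> F n z = G n z.

(** Quotient of formal series, meaningful where [B 0] does not vanish: the
    coefficients q_n solve A_n = \sum_(i <= n) q_i B_(n-i). *)
Fixpoint quot_coefs (R : realType) (a b : nat -> R) (n : nat) : seq R :=
  if n is m.+1 then
    let q := quot_coefs a b m in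
    rcons q ((a m - \sum_(i < m) q`_i * b (m - i)%N) / b 0%N)
  else [::].

Definition series_div (R : realType) (d : nat) (A B : dxseries R d) : dxseries R d :=
  fun n z => (quot_coefs (A^~ z) (B^~ z) n.+1)`_n.

(** The operator dt (partial_t + c_k . nabla)
    = eta dx^2 partial_t + dx e_k . nabla. *)
Definition dtD (R : realType) (d : nat) (eta : R) (e : 'rV[R]_d)
    (F : dxseries R d) : dxseries R d :=
  fun n z => eta * partial_t (mul_dx (mul_dx F) n) z
             + \sum_(j < d) e 0 j * partial_x j (mul_dx F n) z.

(** exp(dt D) - 1; since dt D raises the order in dx by at least one, only the
    powers m <= n contribute to the coefficient of dx^n.  The same remark applies
    to [maxwell] below. *)
Definition expD_sub1 (R : realType) (d : nat) (eta : R) (e : 'rV[R]_d)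
    (F : dxseries R d) : dxseries R d :=
  fun n z => \sum_(1 <= m < n.+1) (m`!%:R)^-1 * iter m (dtD eta e) F n z.

Definition vecseries (R : realType) (d : nat) : Type := 'I_(nvel d) -> dxseries R d.

Definition feq (R : realType) (d : nat) (P : params R) (theta : dxseries R d) :
    vecseries R d :=
  fun k n z => weight P k * theta n z.

(** The operator - Lambda^-1 (exp(dt D) - I), with eta = dt / dx^2. *)
Definition maxwell_step (R : realType) (d : nat) (P : params R) (dx dt : R)
    (F : vecseries R d) : vecseries R d :=
  fun i n z =>
    - \sum_k invmx (Lambda d P (dx / dt)) i k
             * expD_sub1 (dt / dx ^+ 2) (evec R k) (F k) n z.

(** The formal solution
    f = \sum_(m >= 0) (- Lambda^-1 (exp(dt D) - I))^m f^eq. *)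
Definition maxwell (R : realType) (d : nat) (P : params R) (dx dt : R)
    (theta : dxseries R d) : vecseries R d :=
  fun i n z =>
    \sum_(0 <= m < n.+1) iter m (maxwell_step P dx dt) (feq P theta) i n z.

Definition density (R : realType) (d : nat) (P : params R) (dx dt : R)
    (theta : dxseries R d) : dxseries R d :=
  fun n z => \sum_k maxwell P dx dt theta k n z.

(** dx \sum_k c_ki (f_k - f_k^eq), where c_k = c e_k with c = dx/dt = 1/(eta dx)
    is of order dx^-1: the scalar dx * c * e_ki is independent of dx, and the
    leading factor dx makes this an ordinary power series. *)
Definition dx_momentum (R : realType) (d : nat) (P : params R) (dx dt : R)
    (theta : dxseries R d) (i : 'I_d) : dxseries R d :=
  fun n z => \sum_k dx * (dx / dt * evec R k 0 i)
                    * (maxwell P dx dt theta k n z - feq P theta k n z).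

(** The equation \sum_i f_i = theta, divided by dt = eta dx^2, is equivalent up to
    O(dx^p) to partial_t theta = A theta: the latter is what the former becomes
    when it is solved for partial_t theta, with the time derivatives in the higher
    order terms eliminated by means of the equation itself.  The unknown theta is
    a formal series, as solutions of either equation depend on dx. *)
Definition modified_equation (R : realType) (d p : nat) (P : params R)
    (dx dt : R) (A : field R d -> field R d) : Prop :=
  forall theta : dxseries R d, smooth_series theta ->
    (forall z, eq_upto p.+2 (density P dx dt theta) theta z) <->
    (forall z, eq_upto p (fun n => partial_t (theta n)) (fun n => A (theta n)) z).

Definition scaled_laplacian (R : realType) (d : nat) (upsilon : R)
    (u : field R d) : field R d :=
  fun z => upsilon * laplacian u z.

(** The computed velocity is u_i + O(dx^p), where u = - 2 upsilon nabla theta / theta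
    and theta solves \sum_i f_i = theta up to O(dt dx^p); both sides have been
    multiplied by dx, see [dx_momentum]. *)
Definition velocity_accurate (R : realType) (d p : nat) (upsilon : R)
    (P : params R) (dx dt : R) : Prop :=
  forall theta : dxseries R d, smooth_series theta ->
    (forall z, eq_upto p.+2 (density P dx dt theta) theta z) ->
  forall (i : 'I_d) (z : 'rV[R]_d * R), theta 0%N z != 0 ->
    eq_upto p.+1
      (fun n z => (2 - s1 P) * series_div (dx_momentum P dx dt theta i)
                                          (density P dx dt theta) n z)
      (mul_dx (fun n z => - 2 * upsilon
                * series_div (fun m => partial_x i (theta m)) theta n z))
      z.

Definition accurate_in_space (R : realType) (d p : nat) (upsilon : R)
    (P : params R) (dx dt : R) : Prop :=
  modified_equation p P dx dt (@scaled_laplacian R d upsilon) /\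
  velocity_accurate d p upsilon P dx dt.

Definition cs2 (R : realType) (d : nat) (P : params R) (c : R) : R :=
  (2 * wax P + 4 * (d%:R - 1) * wdiag P) * c ^+ 2.

(** nabla theta = - s_1/(dt c_s^2) \sum_k c_k (f_k - f_k^eq) + O(dx^p), multiplied
    by dx; the scalar dt c_s^2 does not depend on dx, as dt c^2 = 1/eta. *)
Definition gradient_accurate (R : realType) (d p : nat) (upsilon : R)
    (P : params R) (dx dt : R) : Prop :=
  forall theta : field R d, smooth theta ->
    (forall z, partial_t theta z = upsilon * laplacian theta z) ->
  forall (i : 'I_d) (z : 'rV[R]_d * R),
    eq_upto p.+1
      (mul_dx (const_series (partial_x i theta)))
      (fun n z => - (s1 P / (dt * cs2 d P (dx / dt)))
                  * dx_momentum P dx dt (const_series theta) i n z)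
      z.

Definition xi (R : realType) (s1 : R) : R := s1^-1 - 2^-1.

Definition R1 (R : realType) (w1 s1 s2 : R) : R :=
  6 * (s2 * (s1 - 1) + s1 ^+ 2 + s2 - 2 * s1) - s2 * s1 ^+ 2
  + 6 * w1 * (2 * s1 * (2 - s1) + s2 * (4 + s1 ^+ 2 - 6 * s1)).

Definition Con1 (R : realType) (w1 s1 s2 : R) : R :=
  3 * s1 * (s2 + s1 - 2) - s1 ^+ 2 * s2
  + 6 * w1 * (2 - s1) * (s1 + s2 * (1 - s1)).

Definition Rd1 (R : realType) (d : nat) (w1 wd s1 s21 : R) : R :=
  6 * (s21 * (s1 - 1) + s1 ^+ 2 + s21 - 2 * s1) - s21 * s1 ^+ 2
  + 6 * (w1 + 2 * (d%:R - 1) * wd)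
      * (2 * s1 * (2 - s1) + s21 * (4 + s1 ^+ 2 - 6 * s1)).

Definition Rd2 (R : realType) (d : nat) (w1 wd s1 s21 s22 : R) : R :=
  s1 ^+ 2 * wd * (2 * (s1 - 2) * (2 * s21 + s22) + s21 * s22 * (8 - 3 * s1))
  - 8 * s1 * s21 * s22 * (w1 + 2 * (d%:R - 1) * wd) ^+ 2
  + s22 * (w1 ^+ 2 + 4 * (d%:R - 1) * wd * (w1 + (d%:R - 1) * wd))
        * (8 * (s1 + s21 - s1 ^+ 2 + (s1 - 1) * s1 * s21)
           + (2 - s21) * s1 ^+ 3).

Definition Cond1 (R : realType) (d : nat) (w1 wd s1 s21 : R) : R :=
  3 * s1 * (s21 + s1 - 2) - s1 ^+ 2 * s21
  + 6 * (w1 + 2 * (d%:R - 1) * wd) * (2 - s1) * (s1 + s21 * (1 - s1)).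

Definition Cond2 (R : realType) (d : nat) (w1 wd s1 s21 s22 : R) : R :=
  - (s22 * w1 ^+ 2 + 4 * s22 * (w1 + (d%:R - 1) * wd) * wd * (d%:R - 1))
    * (s1 - 2) * (s1 + s21 - s1 * s21)
  - s1 ^+ 2 * wd * (2 * s21 + s22 - 2 * s21 * s22).

Definition system1 (R : realType) (eps w1 s1 s2 : R) : Prop :=
  [/\ eps = 2 * w1 * xi s1, R1 w1 s1 s2 = 0 & Con1 w1 s1 s2 = 0].

Definition systemd (R : realType) (d : nat) (eps w1 wd s1 s21 s22 : R) : Prop :=
  [/\ eps = (2 * w1 + 4 * (d%:R - 1) * wd) * xi s1,
      Rd1 d w1 wd s1 s21 = 0, Rd2 d w1 wd s1 s21 s22 = 0,
      Cond1 d w1 wd s1 s21 = 0 & Cond2 d w1 wd s1 s21 s22 = 0].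

Definition conditions (R : realType) (d : nat) (eps : R) (P : params R) : Prop :=
  if d == 1%N then system1 eps (wax P) (s1 P) (s21 P)
  else systemd d eps (wax P) (wdiag P) (s1 P) (s21 P) (s22 P).

(* Main.v *)
(** Write h = dx.  In symbols, with T = eta tau for the time derivative and
    E_k = e_k . X for the spatial ones, the coefficient of h^n in f_k is a polynomial
    differential operator applied to theta, and the weighted sums
    sum_k m(e_k) f_k over a monomial m obey a recursion: on the velocity set every
    monomial is a row of M or zero, hence a left eigenvector of Lambda^-1, so that
    Lambda^-1 acts on such a sum by a scalar while exp(dt D_k) - 1 only raises the
    degree of m.  Running the recursion with the isotropic second and fourth moments
    of the weights gives
    density = theta + h^2 G2 theta + h^4 G4 theta + O(h^6), with
    G2 = - s0^-1 (T - eps |X|^2), odd orders vanishing by parity.  The conditions R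
    say that G4 is a multiple of the heat operator T - eps |X|^2, and the conditions
    Con say the same for the h^3 part of the first moments, whose leading part is
    proportional to the gradient.  Both corrections therefore vanish on solutions. *)

Require Import Defs.
From mathcomp Require Import all_boot all_order all_algebra.
From mathcomp Require Import all_classical all_reals all_analysis.
From mathcomp Require Import ring lra.
From mathcomp Require mpoly.
Import (canonicals, coercions) mpoly.

Set Implicit Arguments.
Unset Strict Implicit.
Unset Printing Implicit Defensive.

Import Order.TTheory GRing.Theory Num.Theory.
Import numFieldNormedType.Exports.

Local Open Scope ring_scope.

(** * Symmetry of second derivatives *)

(** The model is stated with pointwise directional derivatives, while the recursion is algebra in
    commuting letters T and X. The bridge is that partial derivatives of a smooth field commute:
    polynomials then act on fields with products becoming compositions, and the expansion of f can
    be carried out in any commutative ring, where [ring] settles each identity. A second obstacle is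
    that [invmx] has a default value on singular matrices, so nothing is known about Lambda^-1 until
    M is shown invertible. This is interpolation: the indicator of a velocity is a product of
    one-variable Lagrange polynomials, and every monomial in it reduces on the lattice to a row of M
    or to zero. The number of conditions has an algebraic origin. Dividing G4 by T - eps |X|^2
    leaves a remainder alpha |X|^4 + beta sum_j X_j^4; the second invariant appears because the
    fourth moments of the weights need not be isotropic (e^4 = e^2 for each component). For d = 1
    the invariants coincide and alpha + beta = 0 suffices; for d > 1 both coefficients are made to
    vanish. Here alpha + beta is a multiple of [Rd1] and alpha one of [Rd2]; [Cond1] and [Cond2]
    play the same part at order h^3. *)

Lemma line_derive (R : realType) (V : normedModType R) (u : V -> R) (w v : V) (t : R) :
  derivable u (w + t *: v) v ->
  is_derive t 1 (fun r : R => u (w + r *: v)) ('D_v u (w + t *: v)).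
Proof.
have e : (fun h : R => h^-1 *: (((fun r : R => u (w + r *: v)) \o shift t) (h *: 1)
                                - u (w + t *: v))) =
         (fun h : R => h^-1 *: ((u \o shift (w + t *: v)) (h *: v) - u (w + t *: v))).
  apply/funext => h /=; congr (_ *: (u _ - _)).
  by rewrite (mulr1 h : h *: (1 : R) = h) scalerDl addrCA.
move=> du; split; first by rewrite /derivable e.
by rewrite /derive e.
Qed.

(** The mean value theorem is used twice: on the difference between two lines parallel to [a], then
    on ['D_a u] along [b]. The left-hand side is symmetric in [a] and [b], which is what [schwarz]
    exploits. *)
Lemma second_difference (R : realType) (V : normedModType R) (u : V -> R) (z a b : V)
    (h : R) : 0 < h ->
  (forall w, derivable u w a) -> (forall w, derivable ('D_a u) w b) ->
  exists x y, [/\ 0 < x < h, 0 < y < h &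
    u (z + h *: a + h *: b) - u (z + h *: a) - u (z + h *: b) + u z
      = 'D_b ('D_a u) (z + x *: a + y *: b) * h ^+ 2].
Proof.
move=> h0 da dab.
pose g (r : R) := u (z + h *: b + r *: a) - u (z + r *: a).
pose dg (r : R) : R := 'D_a u (z + h *: b + r *: a) - 'D_a u (z + r *: a).
have gd (r : R) : is_derive r (1 : R) g (dg r).
  by apply: is_deriveB; apply: line_derive.
have [x xh ex] : exists2 x, x \in `]0, h[ & g h - g 0 = dg x * (h - 0).
  apply: MVT => //.
  by apply: derivable_within_continuous => x _; apply: ex_derive.
pose k (r : R) : R := 'D_a u (z + x *: a + r *: b).
pose dk (r : R) : R := 'D_b ('D_a u) (z + x *: a + r *: b).
have kd (r : R) : is_derive r (1 : R) k (dk r) by apply: line_derive.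
have [y yh ey] : exists2 y, y \in `]0, h[ & k h - k 0 = dk y * (h - 0).
  apply: MVT => //.
  by apply: derivable_within_continuous => y _; apply: ex_derive.
exists x, y; split; [by move: xh; rewrite in_itv|by move: yh; rewrite in_itv|].
have e : dg x = k h - k 0 by rewrite /dg /k scale0r addr0 addrAC.
move: ex; rewrite /g scale0r !addr0 subr0 e ey subr0 (addrAC z) => e'.
by rewrite expr2 mulrA -e'; ring.
Qed.

Lemma dist_le_of_common (R : realFieldType) (p q c e : R) :
  `|p - c| < e / 2 -> `|q - c| < e / 2 -> `|p - q| <= e.
Proof.
move=> pc qc; rewrite [e]splitr; apply: le_trans (ler_distD c _ _) _.
by rewrite (distrC c) lerD// ltW.
Qed.

(** The same second difference equals both mixed derivatives at intermediate points. On a small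
    enough parallelogram each is within e / 2 of its value at [z], so the two values at [z] differ
    by at most any e > 0. *)
Lemma schwarz (R : realType) (V : normedModType R) (u : V -> R) (z a b : V) :
  (forall w, derivable u w a) -> (forall w, derivable u w b) ->
  (forall w, derivable ('D_a u) w b) -> (forall w, derivable ('D_b u) w a) ->
  {for z, continuous ('D_b ('D_a u))} -> {for z, continuous ('D_a ('D_b u))} ->
  'D_b ('D_a u) z = 'D_a ('D_b u) z.
Proof.
move=> da db dab dba cab cba; apply/eqP; rewrite -subr_eq0 -normr_eq0.
apply/eqP/le_anti; rewrite normr_ge0 andbT; apply/ler_addgt0Pr => e e0; rewrite add0r.
have e20 : 0 < e / 2 by rewrite divr_gt0.
have /cvgrPdist_lt/(_ _ e20)/nbhs_ballP[r /= r0 hr] := cab.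
have /cvgrPdist_lt/(_ _ e20)/nbhs_ballP[r' /= r'0 hr'] := cba.
pose m := Num.min r r'.
have m0 : 0 < m by rewrite lt_min r0.
have N0 : 0 < `|a| + `|b| + 1 by rewrite ltr_pwDr.
(* The summand 1 keeps the quotient meaningful when [a] and [b] vanish and makes the bound in [near]
   strict. *)
pose h := m / (`|a| + `|b| + 1).
have h0 : 0 < h by rewrite divr_gt0.
have near x y : 0 < x < h -> 0 < y < h -> `|z - (z + x *: a + y *: b)| < m.
  move=> /andP[x0 xh] /andP[y0 yh].
  rewrite -addrA opprD addrA subrr sub0r normrN.
  apply: le_lt_trans (ler_normD _ _) _; rewrite !normrZ !gtr0_norm//.
  have : x * `|a| + y * `|b| <= h * (`|a| + `|b|).
    by rewrite mulrDr lerD// ler_wpM2r// ltW.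
  move=> /le_lt_trans; apply.
  by rewrite /h mulrAC ltr_pdivrMr// ltr_pM2l// ltrDl.
have [x [y [xh yh e1]]] := second_difference z h0 da dab.
have [y' [x' [y'h x'h e2]]] := second_difference z h0 db dba.
have ee : 'D_b ('D_a u) (z + x *: a + y *: b) = 'D_a ('D_b u) (z + y' *: b + x' *: a).
  apply: (mulIf (lt0r_neq0 (exprn_gt0 2 h0))).
  apply: etrans (esym e1) (etrans _ e2).
  have -> : z + h *: b + h *: a = z + h *: a + h *: b by exact: addrAC.
  move: (u (z + h *: a + h *: b)) (u (z + h *: a)) (u (z + h *: b)) (u z) => p q r1 t.
  by rewrite (addrAC p).
have l1 : ball z r (z + x *: a + y *: b).
  by rewrite -ball_normE /=; apply: lt_le_trans (near _ _ xh yh) _; rewrite ge_min lexx.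
have l2 : ball z r' (z + y' *: b + x' *: a).
  rewrite -ball_normE /= (addrAC z).
  by apply: lt_le_trans (near _ _ x'h y'h) _; rewrite ge_min lexx orbT.
have h1 := hr _ l1; have h2 := hr' _ l2; rewrite -ee in h2.
exact: (dist_le_of_common h1 h2).
Qed.

(** * Constant coefficient differential operators and their symbols *)

Section ConstantCoefficients.
Variables (R : realType) (d : nat).
Implicit Types (u v : field R d) (z : 'rV[R]_d * R) (s t : seq (option 'I_d)).

Definition pd (a : option 'I_d) u : field R d :=
  fun z => derive (u : 'rV[R]_d * R -> R) z (axis R a).

Lemma iter_partial_cat s t u :
  iter_partial (s ++ t) u = iter_partial s (iter_partial t u).
Proof. by rewrite /iter_partial foldr_cat. Qed.

Lemma smooth_iter_partial s u : smooth u -> smooth (iter_partial s u).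
Proof. by move=> su t; rewrite -iter_partial_cat. Qed.

Lemma iter_partial_lin s (c : R) u v : smooth u -> smooth v ->
  iter_partial s (fun z => c * u z + v z) =
  (fun z => c * iter_partial s u z + iter_partial s v z).
Proof.
move=> su sv; elim: s => //= a s ->; apply/funext => z.
have [_ /(_ a z) du] := su s; have [_ /(_ a z) dv] := sv s.
move: (iter_partial s u) (iter_partial s v) du dv => U V du dv.
pose U' : 'rV[R]_d * R -> R := U; pose V' : 'rV[R]_d * R -> R := V.
have dcu : derivable (c \*: U') z (axis R a) by exact: (@derivableZ _ _ _ U' c _ _ du).
transitivity (derive ((c \*: U') + V') z (axis R a)) => //.
by rewrite (deriveD dcu dv) (deriveZ c du).
Qed.

Lemma smooth_lin (c : R) u v : smooth u -> smooth v ->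
  smooth (fun z => c * u z + v z).
Proof.
move=> su sv s; rewrite iter_partial_lin //.
have [cu du] := su s; have [cv dv] := sv s; split.
  move=> z; apply: cvgD; last exact: cv.
  by apply: cvgM; [exact: cvg_cst|exact: cu].
move=> a z; apply: derivableD; last exact: dv.
by apply: derivableZ; exact: du.
Qed.

Lemma iter_partial0 s : iter_partial s (fun=> 0) = (fun=> 0) :> field R d.
Proof. by elim: s => //= a s ->; apply/funext => z; rewrite derive_cst. Qed.

Lemma smooth0 : smooth ((fun=> 0) : field R d).
Proof.
move=> s; rewrite iter_partial0; split; first exact: cst_continuous.
by move=> a z; exact: derivable_cst.
Qed.

Lemma pdC a b u : smooth u -> pd a (pd b u) = pd b (pd a u).
Proof.
move=> su; apply/funext => z; apply: schwarz.
- by move=> w; have [_] := su [::]; exact.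
- by move=> w; have [_] := su [::]; exact.
- by move=> w; have [_] := su [:: b]; exact.
- by move=> w; have [_] := su [:: a]; exact.
- by have [+ _] := su [:: a; b]; exact.
- by have [+ _] := su [:: b; a]; exact.
Qed.

Lemma iter_partial_perm s t u : smooth u -> perm_eq s t ->
  iter_partial s u = iter_partial t u.
Proof.
(* Permutations are generated by exchanges of two adjacent blocks, so it is enough to move a block
   [p] past a block [q]. *)
move=> su st; suff h p q w : iter_partial (p ++ q ++ w) u = iter_partial (q ++ p ++ w) u.
  apply: (catCA_perm_ind (P := fun w => iter_partial s u = iter_partial w u) _ st) => //.
  by move=> p q w ->; exact: h.
rewrite 4!iter_partial_cat.
have sw : smooth (iter_partial w u) by exact: smooth_iter_partial.
move: (iter_partial w u) sw => {su}v sv.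
elim: p => //= a p IH; rewrite IH.
have sp : smooth (iter_partial p v) by exact: smooth_iter_partial.
move: (iter_partial p v) sp => {IH sv}v sv.
elim: q => //= b q IH.
have sq : smooth (iter_partial q v) by exact: smooth_iter_partial.
by rewrite -[LHS]/(pd a (pd b _)) pdC // /pd IH.
Qed.

(** The indeterminates of a symbol stand for the partial derivatives; [ord0] is
    the time direction. *)
Definition dseq (m : mpoly.multinom d.+1) : seq (option 'I_d) :=
  flatten [seq nseq (m i) (unlift ord0 i) | i <- enum 'I_d.+1].

Lemma dseq_add m m' :
  perm_eq (dseq (mpoly.mnm_add m m')) (dseq m ++ dseq m').
Proof.
rewrite /dseq; elim: (enum _) => //= i l IH.
by rewrite mpoly.mnmDE nseqD perm_sym perm_catACA perm_cat2l perm_sym.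
Qed.

Lemma dseq_unit i : dseq (mpoly.mnm1 i) = [:: unlift ord0 i].
Proof.
rewrite /dseq -[RHS]/[seq unlift ord0 j | j <- [:: i]].
rewrite -(filter_pred1_uniq (enum_uniq 'I_d.+1) (mem_enum _ i)).
elim: (enum _) => //= j l ->; rewrite mpoly.mnm1E eq_sym /=.
by case: (j == i).
Qed.

(** The constant coefficient differential operator with symbol [p]. *)
Definition act (p : mpoly.mpoly d.+1 R) u : field R d :=
  fun z => \sum_(m <- mpoly.msupp p) mpoly.mcoeff m p * iter_partial (dseq m) u z.

(** Polynomials with different supports can be compared only after their sums run over a common list
    of monomials; the added coefficients are zero. *)
Lemma act_wide (r : seq (mpoly.multinom d.+1)) p u z : uniq r ->
  {subset mpoly.msupp p <= r} ->
  act p u z = \sum_(m <- r) mpoly.mcoeff m p * iter_partial (dseq m) u z.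
Proof.
move=> ur pr; rewrite [RHS](bigID (mem (mpoly.msupp p))) /= [X in _ + X]big1 ?addr0.
  rewrite -[RHS]big_filter; apply: perm_big; apply: uniq_perm.
  - exact: mpoly.msupp_uniq.
  - exact: filter_uniq.
  by move=> m; rewrite mem_filter /=; case: (boolP (m \in _)) => // /pr ->.
by move=> m /mpoly.memN_msupp_eq0 ->; rewrite mul0r.
Qed.

Lemma act_lin (c : R) p q u z : act (c *: p + q) u z = c * act p u z + act q u z.
Proof.
pose r := undup (mpoly.msupp (c *: p + q) ++ mpoly.msupp p ++ mpoly.msupp q).
have ur : uniq r by exact: undup_uniq.
rewrite !(@act_wide r) //; last 3 first.
- by move=> m; rewrite /r mem_undup !mem_cat => ->; rewrite !orbT.
- by move=> m; rewrite /r mem_undup !mem_cat => ->; rewrite !orbT.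
- by move=> m; rewrite /r mem_undup !mem_cat => ->.
rewrite mulr_sumr -big_split; apply: eq_bigr => m _ /=.
by rewrite mpoly.mcoeffD mpoly.mcoeffZ mulrDl mulrA.
Qed.

Lemma act0 u z : act 0 u z = 0.
Proof. by rewrite /act mpoly.msupp0 big_nil. Qed.

Lemma act0_fun u : act 0 u = (fun=> 0).
Proof. by apply/funext => z; exact: act0. Qed.

Lemma actX m u : act (mpoly.mpolyX R m) u = iter_partial (dseq m) u.
Proof.
apply/funext => z.
by rewrite /act mpoly.msuppX big_seq1 mpoly.mcoeffX eqxx mul1r.
Qed.

Lemma actD p q u z : act (p + q) u z = act p u z + act q u z.
Proof. by have := act_lin 1 p q u z; rewrite scale1r mul1r. Qed.

Lemma actZ (c : R) p u z : act (c *: p) u z = c * act p u z.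
Proof. by have := act_lin c p 0 u z; rewrite act0 !addr0. Qed.

Lemma act_sum (I : Type) (r : seq I) (P : pred I) (F : I -> mpoly.mpoly d.+1 R) u z :
  act (\sum_(i <- r | P i) F i) u z = \sum_(i <- r | P i) act (F i) u z.
Proof.
apply: (big_morph (fun p => act p u z)) => [p q|]; first exact: actD.
exact: act0.
Qed.

Lemma act_step (c : R) m p u : act (c *: mpoly.mpolyX R m + p) u =
  (fun z => c * iter_partial (dseq m) u z + act p u z).
Proof. by apply/funext => z; rewrite act_lin actX. Qed.

Lemma smooth_act p u : smooth u -> smooth (act p u).
Proof.
move=> su; elim/mpoly.mpolyind: p => [|c m p _ _ IH].
  by rewrite act0_fun; exact: smooth0.
by rewrite act_step; exact: (smooth_lin c (smooth_iter_partial _ su) IH).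
Qed.

Lemma actXM m q u : smooth u ->
  act (mpoly.mpolyX R m * q) u = iter_partial (dseq m) (act q u).
Proof.
move=> su; elim/mpoly.mpolyind: q => [|c m' q _ _ IH].
  by rewrite mulr0 act0_fun iter_partial0.
rewrite mulrDr -scalerAr -mpoly.mpolyXD act_step IH act_step iter_partial_lin.
- by rewrite (iter_partial_perm su (dseq_add _ _)) iter_partial_cat.
- exact: smooth_iter_partial.
exact: smooth_act.
Qed.

(** Smoothness enters through the symmetry of mixed derivatives: [dseq] lists the derivatives of a
    product of monomials in an order of its own. *)
Lemma actM p q u : smooth u -> act (p * q) u = act p (act q u).
Proof.
move=> su; elim/mpoly.mpolyind: p => [|c m p _ _ IH]; apply/funext => z.
  by rewrite mul0r !act0.
by rewrite mulrDl actD -scalerAl actZ actXM // IH act_step.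
Qed.

Lemma actC (c : R) u z : act (mpoly.mpolyC d.+1 c) u z = c * u z.
Proof.
rewrite -[mpoly.mpolyC _ _]mulr1 mpoly.mul_mpolyC actZ -mpoly.mpolyX0 actX.
congr (_ * _); rewrite (_ : dseq _ = [::]) // /dseq.
by elim: (enum _) => //= i l ->; rewrite mpoly.mnm0E.
Qed.

Lemma act_var i u : act (mpoly.mpolyX R (mpoly.mnm1 i)) u = pd (unlift ord0 i) u.
Proof. by rewrite actX dseq_unit. Qed.

End ConstantCoefficients.

(** * The velocity set and the moment matrix *)

Section Lattice.
Variables (R : realType) (d : nat).
Implicit Types (v w : 'rV[R]_d) (s : seq 'I_d) (f g : 'rV[R]_d -> R).

Local Notation lat := (velset R d).

Lemma scale_unitvE (a : R) (j i : 'I_d) : (a *: unitv R j) 0 i = a * (i == j)%:R.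
Proof. by rewrite !mxE eqxx. Qed.

Lemma in_pairs (p : 'I_d * 'I_d) : (p \in pairs d) = (p.1 < p.2)%N.
Proof. by rewrite mem_filter mem_enum andbT. Qed.

Definition is_sign (a : R) := a = 1 \/ a = -1.

Lemma sign_sqr a : is_sign a -> a * a = 1.
Proof. by case=> ->; rewrite ?mulrNN mulr1. Qed.

Lemma velsetP v : v \in lat ->
  [\/ v = 0, exists j a, is_sign a /\ v = a *: unitv R j
    | exists i j a b, [/\ i != j, is_sign a, is_sign b
                        & v = a *: unitv R i + b *: unitv R j]].
Proof.
rewrite inE mem_cat => /orP[/eqP->|/orP[]]; first by constructor 1.
  case/allpairsP=> -[j a] /= [_ ha ->]; constructor 2; exists j, a; split=> //.
  by move: ha; rewrite !inE => /orP[] /eqP->; [left|right].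
case/allpairsP=> -[p ab] /= [hp hab ->]; constructor 3.
exists p.1, p.2, ab.1, ab.2; split => //.
- by move: hp; rewrite in_pairs -val_eqE neq_ltn => ->.
- by move: hab; rewrite !inE => /or4P[] /eqP->; [left|left|right|right].
by move: hab; rewrite !inE => /or4P[] /eqP->; [left|right|left|right].
Qed.

Lemma velset_cube v i : v \in lat -> v 0 i ^+ 3 = v 0 i.
Proof.
have h (a : R) : is_sign a -> a ^+ 3 = a.
  by move=> /sign_sqr; rewrite !exprS expr0 mulr1 mulrA => ->; rewrite mul1r.
case/velsetP=> [->|[j [a [sa ->]]]|[j [l [a [b [jl sa sb ->]]]]]].
- by rewrite mxE expr0n.
- by rewrite scale_unitvE; case: eqP; rewrite ?mulr1 ?mulr0 ?expr0n //= h.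
rewrite mxE !scale_unitvE; case: (eqVneq i j) => [->|_]; rewrite ?(negPf jl).
  by rewrite mulr1 mulr0 addr0 h.
by case: eqP; rewrite mulr0 add0r ?mulr1 ?mulr0 ?expr0n //= h.
Qed.

Lemma velset_triple v i j l : v \in lat -> i != j -> i != l -> j != l ->
  v 0 i * v 0 j * v 0 l = 0.
Proof.
move=> + ij il jl; case/velsetP=> [->|[m [a [sa ->]]]|[m [n [a [b [mn sa sb ->]]]]]].
- by rewrite !mxE !mul0r.
- rewrite !scale_unitvE; case: (eqVneq i m) => [im|_]; last by rewrite mulr0 !mul0r.
  by rewrite eq_sym -im (negPf ij) !mulr0 mul0r.
rewrite !mxE -![R in RHS]/R.
have hh (x y z : 'I_d) : x != y -> (x == z) && (y == z) = false.
  by apply: contraNF => /andP[/eqP-> /eqP->].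
have := hh i j m ij; have := hh i l m il; have := hh j l m jl.
have := hh i j n ij; have := hh i l n il; have := hh j l n jl.
rewrite !eqxx.
by case: (i == m); case: (i == n); case: (j == m); case: (j == n);
   case: (l == m); case: (l == n) => //= *; rewrite ?(mulr0, addr0, mul0r).
Qed.

Definition mono s v : R := \prod_(i <- s) v 0 i.

Lemma mono_cons i s v : mono (i :: s) v = v 0 i * mono s v.
Proof. by rewrite /mono big_cons. Qed.

Lemma velset_pow v i (a : bool) : v \in lat -> v 0 i * v 0 i ^+ (1 + a) = v 0 i ^+ (1 + ~~ a).
Proof. by case: a => /= lv; rewrite -exprS // velset_cube. Qed.

(** Components lie in {-1, 0, 1}, so x^3 = x brings each exponent down to 1 or 2, and at most two
    components are nonzero, so a third index kills the monomial. The booleans are the exponents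
    minus one. *)
Lemma mono_reduce s :
  [\/ {in lat, forall v, mono s v = 0}, {in lat, forall v, mono s v = 1},
      exists i (a : bool), {in lat, forall v, mono s v = v 0 i ^+ (1 + a)}
    | exists i l (a b : bool), i != l /\
        {in lat, forall v, mono s v = v 0 i ^+ (1 + a) * v 0 l ^+ (1 + b)}].
Proof.
elim: s => [|j s [] IH].
- by constructor 2 => v _; rewrite /mono big_nil.
- by constructor 1 => v lv; rewrite mono_cons IH // mulr0.
- by constructor 3; exists j, false => v lv; rewrite mono_cons IH // mulr1.
- case: IH => i [a IH]; case: (eqVneq i j) => [ij|ij].
    by constructor 3; exists i, (~~ a) => v lv; rewrite mono_cons IH // -ij velset_pow.
  constructor 4; exists j, i, false, a; rewrite eq_sym; split=> // v lv.
  by rewrite mono_cons IH.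
case: IH => i [l [a [b [il IH]]]].
case: (eqVneq i j) => [ij|ij].
  constructor 4; exists i, l, (~~ a), b; split=> // v lv.
  by rewrite mono_cons IH // -ij mulrA velset_pow.
case: (eqVneq l j) => [lj|lj].
  constructor 4; exists i, l, a, (~~ b); split=> // v lv.
  by rewrite mono_cons IH // -lj mulrCA velset_pow.
constructor 1 => v lv; rewrite mono_cons IH // !exprS.
have t := velset_triple lv il ij lj.
rewrite [RHS](_ : 0 = v 0 i * v 0 l * v 0 j * (v 0 i ^+ a * v 0 l ^+ b)); first ring.
by rewrite t mul0r.
Qed.

Lemma diagonal_eq_supp (a b a' b' : R) (i j i' j' : 'I_d) : a != 0 -> i != j ->
  a *: unitv R i + b *: unitv R j = a' *: unitv R i' + b' *: unitv R j' ->
  i \in [:: i'; j'].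
Proof.
move=> a0 ij /(congr1 (fun v : 'rV_d => v 0 i)); rewrite !mxE !eqxx /= (negPf ij).
rewrite mulr0 mulr1 addr0 !inE => e; apply: contraNT a0.
by rewrite negb_or e => /andP[/negPf-> /negPf->]; rewrite !mulr0 addr0.
Qed.

(** Makes [evec] injective, so that the indicator of a velocity singles out one column of M. For
    diagonal velocities the supports are compared first, the ordering inside a pair excludes a swap
    of the axes, and then the signs are read off. *)
Lemma velset_uniq : uniq lat.
Proof.
have n1 : (1 == -1 :> R) = false by rewrite gt_eqF //; lra.
have n1' : (-1 == 1 :> R) = false by rewrite eq_sym.
have s2 (a : R) : a \in [:: 1; -1] -> a != 0.
  by rewrite !inE => /orP[] /eqP->; rewrite ?oppr_eq0 oner_eq0.
have s4 (ab : R * R) : ab \in [:: (1, 1); (1, -1); (-1, 1); (-1, -1)] ->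
    ab.1 != 0 /\ ab.2 != 0.
  by rewrite !inE => /or4P[] /eqP-> /=; rewrite ?oppr_eq0 oner_eq0.
rewrite /velset cons_uniq mem_cat cat_uniq; apply/and4P; split.
- apply/negP => /orP[] /allpairsP[[x y] /= [hx hy]].
    move=> /(congr1 (fun v : 'rV_d => v 0 x)); rewrite scale_unitvE eqxx mulr1 mxE.
    by move=> y0; have := s2 _ hy; rewrite -y0 eqxx.
  move: hx; rewrite in_pairs => hx.
  move=> /(congr1 (fun v : 'rV_d => v 0 x.1)); rewrite [RHS]mxE !scale_unitvE eqxx mulr1 mxE.
  have -> : (x.1 == x.2) = false by rewrite -val_eqE ltn_eqF.
  by rewrite mulr0 addr0 => y0; have [] := s4 _ hy; rewrite -y0 eqxx.
- apply: allpairs_uniq; [exact: enum_uniq|by rewrite /= inE n1|].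
  move=> u v hu hv.
  case/allpairsP: hu => -[i a] /= [_ ha ->].
  case/allpairsP: hv => -[j b] /= [_ hb ->] e.
  have := congr1 (fun v : 'rV_d => v 0 i) e; rewrite /= !scale_unitvE eqxx mulr1.
  case: (eqVneq i j) => [->|_]; first by rewrite mulr1 => ->.
  by rewrite mulr0 => a0; have := s2 _ ha; rewrite a0 eqxx.
- apply/hasPn => u hu; case/allpairsP: hu => -[p ab] /= [hp hab ->]; apply/negP.
  move=> hv; have [j [c e]] : exists j c,
      ab.1 *: unitv R p.1 + ab.2 *: unitv R p.2 = c *: unitv R j.
    case/flattenP: hv => _ /mapP[j _ ->]; rewrite !inE => /orP[] /eqP->; first by exists j, 1.
    by exists j, (-1).
  rewrite in_pairs in hp.
  have [a0 b0] := s4 _ hab.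
  have pn : (p.1 == p.2) = false by rewrite -val_eqE ltn_eqF.
  have := congr1 (fun v : 'rV_d => v 0 p.1) e.
  have := congr1 (fun v : 'rV_d => v 0 p.2) e.
  rewrite !mxE !eqxx /= pn eq_sym pn !mulr0 !mulr1 addr0 add0r.
  case: (eqVneq p.1 j) => [<-|_].
    by rewrite eq_sym pn mulr0 => e2; rewrite e2 eqxx in b0.
  by rewrite mulr0 => _ e1; rewrite e1 eqxx in a0.
apply: allpairs_uniq.
- by rewrite filter_uniq ?enum_uniq.
- by rewrite /= !inE !xpair_eqE !n1 !n1' !andbF.
move=> u v hu hv.
case/allpairsP: hu => -[p x] /= [hp hx ->].
case/allpairsP: hv => -[r y] /= [hr hy ->] e.
rewrite !in_pairs in hp hr.
have [x1 x2] := s4 _ hx; have [y1 y2] := s4 _ hy.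
have pn : p.1 != p.2 by rewrite -val_eqE neq_ltn hp.
have rn : r.1 != r.2 by rewrite -val_eqE neq_ltn hr.
have m1 := diagonal_eq_supp x1 pn e.
have m2 : p.2 \in [:: r.2; r.1].
  apply: (@diagonal_eq_supp x.2 x.1 y.2 y.1 p.2 p.1 r.2 r.1 x2); first by rewrite eq_sym.
  by rewrite [LHS]addrC [RHS]addrC; exact: e.
have epr : p = r.
  case: p r hp hr pn rn m1 m2 {e} => [p1 p2] [r1 r2] /= hp hr pn rn.
  rewrite !inE => /orP[] /eqP e1 /orP[] /eqP e2; rewrite e1 e2 // in pn hp *.
  - by rewrite eqxx in pn.
  - by rewrite eqxx in pn.
  by rewrite ltnNge ltnW in hp.
rewrite -epr in e *; congr (_, _).
have := congr1 (fun v : 'rV_d => v 0 p.1) e.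
have := congr1 (fun v : 'rV_d => v 0 p.2) e.
rewrite !mxE !eqxx /= (negPf pn) eq_sym (negPf pn) !mulr0 !mulr1 !addr0 !add0r.
by case: x y {hx hy x1 x2 y1 y2 e m1 m2} => x1 x2 [y1 y2] /= -> ->.
Qed.

(** * Rows of M, interpolation on the lattice and left eigenvectors of Lambda^-1 *)

Variable P : params R.

Local Notation q := (nvel d).
Local Notation e_ := (@evec R d).

Lemma evec_in k : e_ k \in lat.
Proof. by apply: mem_nth; rewrite size_velset. Qed.

Lemma evec_inj : injective e_.
Proof.
move=> k l e; apply/val_inj/eqP => /=.
have h (m : 'I_q) : (m < size lat)%N by rewrite size_velset.
by rewrite -(nth_uniq 0 (h k) (h l) velset_uniq); apply/eqP.
Qed.

Lemma moment_of_mem f r : (f, r) \in moments d P -> exists a : 'I_q, moment P a = (f, r).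
Proof.
case/(nthP (fun=> 0, 0)) => i; rewrite size_moments => iq e.
by exists (Ordinal iq).
Qed.

Lemma moment_mem (a : 'I_q) : moment P a \in moments d P.
Proof. by apply: mem_nth; rewrite size_moments. Qed.

Lemma moment0 : exists a : 'I_q, moment P a = (fun=> 1, s0 P).
Proof. by apply: moment_of_mem; rewrite inE eqxx. Qed.

Lemma moment1 i : exists a : 'I_q, moment P a = (fun v => v 0 i, s1 P).
Proof.
apply: moment_of_mem; rewrite inE !mem_cat; apply/orP; right; apply/orP; left.
exact: (map_f (fun j : 'I_d => (fun v : 'rV[R]_d => v 0 j, s1 P))) (mem_enum _ i).
Qed.

Lemma moment_sq i : exists a : 'I_q, moment P a = (fun v => v 0 i ^+ 2, s21 P).
Proof.
apply: moment_of_mem; rewrite inE !mem_cat; do 2 (apply/orP; right); apply/orP; left.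
exact: (map_f (fun j : 'I_d => (fun v : 'rV[R]_d => v 0 j ^+ 2, s21 P))) (mem_enum _ i).
Qed.

(** The rows are listed for i < j only, but exchanging the indices together with the exponents
    permutes the mixed types, and the rate depends only on whether both exponents are 1. *)
Lemma moment_pair i j (a b : bool) : i != j -> exists (k : 'I_q) (f : 'rV[R]_d -> R),
  moment P k = (f, if a || b then 1 else s22 P) /\
  forall v, f v = v 0 i ^+ (1 + a) * v 0 j ^+ (1 + b).
Proof.
wlog ij : i j a b / (i < j)%N.
  move=> h; rewrite -val_eqE neq_ltn => /orP[] ij; first by apply: h; rewrite // -val_eqE ltn_eqF.
  have [|k [f [e fe]]] := h j i b a ij; first by rewrite -val_eqE ltn_eqF.
  exists k, f; rewrite orbC; split=> // v; by rewrite mulrC.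
move=> _; have hp : (i, j) \in pairs d by rewrite in_pairs.
have sub (s : seq (('rV[R]_d -> R) * R)) f r : (f, r) \in s ->
    {subset s <= moments d P} -> exists a : 'I_q, moment P a = (f, r).
  by move=> h sm; apply: moment_of_mem; exact: sm.
case: a b => -[].
- have [|k hk] := sub _ _ _ (map_f (fun p : 'I_d * 'I_d =>
     (fun v : 'rV[R]_d => v 0 p.1 ^+ 2 * v 0 p.2 ^+ 2, 1 : R)) hp).
    by move=> x hx; rewrite inE !mem_cat hx !orbT.
  by exists k, (fun v => v 0 i ^+ 2 * v 0 j ^+ 2).
- have [|k hk] := sub _ _ _ (map_f (fun p : 'I_d * 'I_d =>
     (fun v : 'rV[R]_d => v 0 p.1 ^+ 2 * v 0 p.2, 1 : R)) hp).
    by move=> x hx; rewrite inE !mem_cat hx !orbT.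
  by exists k, (fun v => v 0 i ^+ 2 * v 0 j).
- have [|k hk] := sub _ _ _ (map_f (fun p : 'I_d * 'I_d =>
     (fun v : 'rV[R]_d => v 0 p.1 * v 0 p.2 ^+ 2, 1 : R)) hp).
    by move=> x hx; rewrite inE !mem_cat hx !orbT.
  by exists k, (fun v => v 0 i * v 0 j ^+ 2).
have [|k hk] := sub _ _ _ (map_f (fun p : 'I_d * 'I_d =>
     (fun v : 'rV[R]_d => v 0 p.1 * v 0 p.2, s22 P)) hp).
  by move=> x hx; rewrite inE !mem_cat hx !orbT.
by exists k, (fun v => v 0 i * v 0 j).
Qed.

Lemma moment_scale (a : 'I_q) (c : R) : c != 0 ->
  exists2 r, r != 0 & forall v, (moment P a).1 (c *: v) = r * (moment P a).1 v.
Proof.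
move=> c0; have := moment_mem a; move: (moment P a) => m.
rewrite inE !mem_cat => /predU1P[->|/orP[/mapP[x _ ->]|/orP[/mapP[x _ ->]|
  /orP[/mapP[x _ ->]|/orP[/mapP[x _ ->]|/orP[/mapP[x _ ->]|/mapP[x _ ->]]]]]]].
- by exists 1; rewrite ?oner_eq0 // => v; rewrite mul1r.
- by exists c => // v; rewrite /= mxE.
- by exists (c ^+ 2); rewrite ?expf_neq0 // => v; rewrite /= mxE exprMn.
- by exists (c ^+ 2); rewrite ?expf_neq0 // => v; rewrite /= !mxE; ring.
- by exists (c ^+ 3); rewrite ?expf_neq0 // => v; rewrite /= !mxE; ring.
- by exists (c ^+ 3); rewrite ?expf_neq0 // => v; rewrite /= !mxE; ring.
by exists (c ^+ 4); rewrite ?expf_neq0 // => v; rewrite /= !mxE; ring.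
Qed.

Lemma moment_rate_neq0 (a : 'I_q) : admissible d P -> (moment P a).2 != 0.
Proof.
case=> /andP[h0 _] /andP[h1 _] /andP[h2 _] h3.
have := moment_mem a; move: (moment P a) => m.
rewrite inE !mem_cat => /predU1P[->|/orP[/mapP[x hx ->]|/orP[/mapP[x hx ->]|
  /orP[/mapP[x hx ->]|/orP[/mapP[x hx ->]|/orP[/mapP[x hx ->]|/mapP[x hx ->]]]]]]].
all: rewrite /= ?oner_eq0 ?gt_eqF //.
rewrite in_pairs in hx; have /h3/andP[] // : (1 < d)%N.
by apply: leq_ltn_trans (ltn_ord x.2); apply: leq_ltn_trans hx.
Qed.

Definition spanned f := exists b : 'I_q -> R,
  {in lat, forall v, f v = \sum_a b a * (moment P a).1 v}.

Lemma spanned_moment (a : 'I_q) : spanned (moment P a).1.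
Proof.
exists (fun b => (b == a)%:R) => v _; rewrite (bigD1 a) //= eqxx mul1r big1 ?addr0 //.
by move=> b /negPf->; rewrite mul0r.
Qed.

Lemma spanned_eq f g : {in lat, f =1 g} -> spanned f -> spanned g.
Proof. by move=> fg [b hb]; exists b => v lv; rewrite -fg // hb. Qed.

Lemma spanned_lin (c : R) f g : spanned f -> spanned g -> spanned (fun v => c * f v + g v).
Proof.
move=> [b hb] [b' hb']; exists (fun a => c * b a + b' a) => v lv.
rewrite hb // hb' // mulr_sumr -big_split /=; apply: eq_bigr => a _.
by rewrite mulrDl mulrA.
Qed.

Lemma spanned_mono s : spanned (mono s).
Proof.
have [h|h|[i [[] h]]|[i [l [a [b [il h]]]]]] := mono_reduce s.
- by exists (fun=> 0) => v lv; rewrite h // big1 // => a _; rewrite mul0r.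
- have [a ha] := moment0; have := spanned_moment a; rewrite ha /=; apply: spanned_eq => v lv.
  by rewrite h.
- have [a ha] := moment_sq i; have := spanned_moment a; rewrite ha /=; apply: spanned_eq => v lv.
  by rewrite h.
- have [a ha] := moment1 i; have := spanned_moment a; rewrite ha /=; apply: spanned_eq => v lv.
  by rewrite h.
have [k [f [hk hf]]] := moment_pair a b il.
have := spanned_moment k; rewrite hk /=; apply: spanned_eq => v lv.
by rewrite h // hf.
Qed.

(** Lagrange interpolation: these indicators span all functions on the lattice, so the rows of M do
    too, which is the invertibility of M. *)
Lemma spanned_indicator w : w \in lat -> spanned (fun v => (v == w)%:R).
Proof.
move=> lw.
(* On {-1, 0, 1} this is 1 at x = w_i and 0 elsewhere: it reads 1 - x^2 if w_i = 0 and (x^2 + w_i x)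
   / 2 if w_i = 1 or -1. *)
pose ell i (x : R) := (1 - w 0 i ^+ 2) * (1 - x ^+ 2) + w 0 i ^+ 2 * (x ^+ 2 + w 0 i * x) / 2.
have cube (x : R) : x ^+ 3 = x -> [\/ x = 0, x = 1 | x = -1].
  move=> x3; have : x * ((x - 1) * (x + 1)) = 0.
    have -> : x * ((x - 1) * (x + 1)) = x ^+ 3 - x by ring.
    by rewrite x3 subrr.
  move/eqP; rewrite !mulf_eq0 => /or3P[] /eqP h; [constructor 1|constructor 2|constructor 3] => //.
    by rewrite -[x](subrK 1) h add0r.
  by rewrite -[x](addrK 1) h add0r.
apply: (@spanned_eq (fun v => \prod_i ell i (v 0 i))) => [v lv|].
  rewrite (eq_bigr (fun i => (v 0 i == w 0 i)%:R)) => [|i _]; last first.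
    have n1 : (1 == -1 :> R) = false by rewrite gt_eqF //; lra.
    have n1' : (-1 == 1 :> R) = false by rewrite eq_sym.
    have n0 : (1 == 0 :> R) = false by rewrite oner_eq0.
    have n0' : (-1 == 0 :> R) = false by rewrite oppr_eq0 oner_eq0.
    have m0 : (0 == 1 :> R) = false by rewrite eq_sym.
    have m0' : (0 == -1 :> R) = false by rewrite eq_sym.
    rewrite /ell; case: (cube _ (velset_cube i lv)) => ->;
      case: (cube _ (velset_cube i lw)) => ->;
      rewrite ?eqxx ?n1 ?n1' ?n0 ?n0' ?m0 ?m0' /=; by field.
  case: (eqVneq v w) => [->|vw]; first by rewrite big1 // => i _; rewrite eqxx.
  have [i hi] : exists i, v 0 i != w 0 i.
    apply/existsP; apply: contraNT vw; rewrite negb_exists => /forallP h.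
    by apply/eqP/rowP => i; apply/eqP; have := h i; rewrite negbK.
  by rewrite (bigD1 i) //= (negPf hi) mul0r.
(* The product of quadratics is expanded one factor at a time; the monomial [s] collects the terms
   already chosen. *)
suff h (r : seq 'I_d) s : spanned (fun v => mono s v * \prod_(i <- r) ell i (v 0 i)).
  apply: spanned_eq (h (enum 'I_d) [::]) => v _.
  by rewrite /mono big_nil mul1r big_enum.
elim: r s => [|i r IH] s.
  by apply: spanned_eq (spanned_mono s) => v _; rewrite big_nil mulr1.
(* The coefficients of 1, x^2 and x in [ell]. The innermost combinations 0 f + (- f + f) supply the
   zero function that closes the chain. *)
apply: spanned_eq (spanned_lin (1 - w 0 i ^+ 2) (IH s)
  (spanned_lin (w 0 i ^+ 2 / 2 - (1 - w 0 i ^+ 2)) (IH (i :: i :: s))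
  (spanned_lin (w 0 i ^+ 3 / 2) (IH (i :: s))
     (spanned_lin 0 (IH s) (spanned_lin (-1) (IH s) (IH s)))))) => v _ /=.
by rewrite big_cons !mono_cons /ell; field.
Qed.

Hypothesis Padm : admissible d P.

Definition left_eigen c f (r : R) :=
  forall k, \sum_i f (e_ i) * invmx (Lambda d P c) i k = r * f (e_ k).

(** Lambda = M^-1 S M gives M Lambda^-1 = S^-1 M; row [a] of this identity is the claim, once the
    homogeneity factor in [c] is cancelled. *)
Lemma left_eigen_moment c (a : 'I_q) : c != 0 ->
  left_eigen c (moment P a).1 (moment P a).2^-1.
Proof.
move=> c0.
have /choice[x hx] : forall a : 'I_q, exists y : R, y != 0 /\
    forall v, (moment P a).1 (c *: v) = y * (moment P a).1 v.
  by move=> b; have [r r0 hr] := moment_scale b c0; exists r.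
have /choice[b hb] : forall l, exists y : 'I_q -> R, {in lat, forall v,
    (v == e_ l)%:R = \sum_a y a * (moment P a).1 v}.
  by move=> l; exact: spanned_indicator (evec_in l).
pose M := Mmx d P c.
have uM : M \in unitmx.
  (* A left inverse of M: row l holds the coefficients of the indicator of velocity l, corrected for
     the scaling of each row of M by a power of [c]. *)
  pose N : 'M[R]_q := \matrix_(l, a) (b l a / x a).
  have NM : N *m M = 1%:M.
    apply/matrixP => l k; rewrite !mxE eq_sym -(inj_eq evec_inj) hb ?evec_in //.
    apply: eq_bigr => m _; have [x0 xm] := hx m.
    by rewrite !mxE xm mulrA divfK.
  by have [] := mulmx1_unit NM.
pose Si : 'M[R]_q := diag_mx (\row_a (moment P a).2^-1).
have SSi : Smx d P *m Si = 1%:M.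
  rewrite /Smx mulmx_diag -diag_const_mx; congr diag_mx; apply/rowP => m.
  by rewrite !mxE mulfV // moment_rate_neq0.
have LL : Lambda d P c *m (invmx M *m Si *m M) = 1%:M.
  rewrite /Lambda -/M -!mulmxA (mulmxA M) mulmxV // mul1mx (mulmxA (Smx d P)) SSi.
  by rewrite mul1mx mulVmx.
have [uL _] := mulmx1_unit LL.
have e : M *m invmx (Lambda d P c) = Si *m M.
  have -> : invmx (Lambda d P c) = invmx M *m Si *m M.
    by rewrite -[LHS]mulmx1 -LL mulmxA mulVmx // mul1mx.
  by rewrite !mulmxA (mulmxV uM) mul1mx.
move=> k; have [x0 xa] := hx a.
have := congr1 (fun A : 'M[R]_q => A a k) e; rewrite mul_diag_mx !mxE xa => e'.
apply: (mulfI x0); rewrite mulrCA -e' mulr_sumr; apply: eq_bigr => i _.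
by rewrite !mxE xa mulrA.
Qed.

Lemma left_eigen_eq c f g r : {in lat, f =1 g} -> left_eigen c f r -> left_eigen c g r.
Proof.
move=> fg h k; rewrite -fg ?evec_in // -h; apply: eq_bigr => i _.
by rewrite fg ?evec_in.
Qed.

Section Eigen.
Variables (c : R) (c0 : c != 0).

Lemma eigen_nil : left_eigen c (mono [::]) (s0 P)^-1.
Proof.
have [a ha] := moment0; have := left_eigen_moment a c0; rewrite ha /=.
by apply: left_eigen_eq => v _; rewrite /mono big_nil.
Qed.

Lemma eigen_pow i (a : bool) s : {in lat, forall v, mono s v = v 0 i ^+ (1 + a)} ->
  left_eigen c (mono s) (if a then (s21 P)^-1 else (s1 P)^-1).
Proof.
case: a => h; [have [a ha] := moment_sq i | have [a ha] := moment1 i];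
  have := left_eigen_moment a c0; rewrite ha /=; apply: left_eigen_eq => v lv;
  by rewrite h.
Qed.

Lemma eigen_pair i j (a b : bool) s : i != j ->
  {in lat, forall v, mono s v = v 0 i ^+ (1 + a) * v 0 j ^+ (1 + b)} ->
  left_eigen c (mono s) (if a || b then 1 else (s22 P)^-1).
Proof.
move=> ij h; have [k [f [hk hf]]] := moment_pair a b ij.
have := left_eigen_moment k c0; rewrite hk /= (fun_if (@GRing.inv R)) invr1.
by apply: left_eigen_eq => v lv; rewrite h // hf.
Qed.

Lemma eigen_zero s r : {in lat, forall v, mono s v = 0} -> left_eigen c (mono s) r.
Proof.
move=> h k; rewrite h ?evec_in // mulr0 big1 // => i _.
by rewrite h ?evec_in // mul0r.
Qed.

(** For the parity argument the value of the eigenvalue is irrelevant; only that Lambda^-1 acts by a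
    scalar matters. *)
Lemma eigen_exists s : exists r, left_eigen c (mono s) r.
Proof.
have [h|h|[i [a h]]|[i [l [a [b [il h]]]]]] := mono_reduce s.
- by exists 0; exact: eigen_zero.
- exists (s0 P)^-1; apply: left_eigen_eq eigen_nil => v lv.
  by rewrite h // /mono big_nil.
- by eexists; exact: (eigen_pow h).
by eexists; exact: (eigen_pair il h).
Qed.

End Eigen.

End Lattice.

(** * Moments of the weights *)

Section Averages.
Variables (R : realType) (d : nat) (P : params R).
Implicit Types (v w : 'rV[R]_d) (s : seq 'I_d) (f g : 'rV[R]_d -> R).

Local Notation lat := (velset R d).
Local Notation e_ := (@evec R d).
Local Notation "'u_ j" := (unitv R j) (at level 8, format "''u_' j").

Definition avg f : R := \sum_k weight P k * f (e_ k).

Lemma avg_eq f g : {in lat, f =1 g} -> avg f = avg g.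
Proof. by move=> fg; apply: eq_bigr => k _; rewrite fg ?evec_in. Qed.

Lemma avgE f : avg f = wzero d P * f 0
  + wax P * \sum_j (f 'u_j + f (- 'u_j))
  + wdiag P * \sum_(p <- pairs d) (f ('u_p.1 + 'u_p.2) + f ('u_p.1 - 'u_p.2)
                                   + f (- 'u_p.1 + 'u_p.2) + f (- 'u_p.1 - 'u_p.2)).
Proof.
pose ax := [seq a *: 'u_j | j <- enum 'I_d, a <- [:: 1; -1 : R]].
pose dg := [seq ab.1 *: 'u_p.1 + ab.2 *: 'u_p.2
         | p <- pairs d, ab <- [:: (1, 1); (1, -1); (-1, 1); (-1, -1) : R * R]].
pose wt (n : nat) := if n == 0%N then wzero d P else if (n <= 2 * d)%N then wax P else wdiag P.
have sax : size ax = (2 * d)%N by rewrite size_allpairs size_enum_ord mulnC.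
have sl : nvel d = (size ax + size dg).+1 by rewrite -(size_velset R) /velset /= size_cat.
transitivity (\sum_(0 <= n < nvel d) wt n * f (nth 0 lat n)).
  by rewrite big_mkord.
rewrite sl big_nat_recl //= -addrA; congr (_ + _).
rewrite (big_cat_nat (n := size ax)) ?leq_addr //=; congr (_ + _).
  rewrite (eq_big_nat _ _ (F2 := fun n => wax P * f (nth 0 ax n))); last first.
    move=> n /andP[_ hn]; rewrite /wt /= -sax hn; congr (_ * f _).
    by rewrite nth_cat hn.
  rewrite -big_distrr -(big_nth _ xpredT f) /= big_allpairs_dep big_enum /=; congr (_ * _).
  by apply: eq_bigr => j _; rewrite big_cons big_seq1 scale1r scaleN1r.
rewrite -{1}[size ax]add0n big_addn addKn.
rewrite (eq_big_nat _ _ (F2 := fun n => wdiag P * f (nth 0 dg n))); last first.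
  move=> n _; rewrite /wt /= -sax ltnNge leq_addl /=; congr (_ * f _).
  by rewrite nth_cat ltnNge leq_addl /= addnK.
rewrite -big_distrr -(big_nth _ xpredT f) /= big_allpairs_dep; congr (_ * _).
by apply: eq_bigr => p _; rewrite !big_cons big_nil /= !scale1r !scaleN1r addr0 !addrA.
Qed.

Lemma sum_pairs (F : 'I_d -> 'I_d -> R) :
  \sum_(p <- pairs d) (F p.1 p.2 + F p.2 p.1) = \sum_i \sum_(j | j != i) F i j.
Proof.
have h (G : 'I_d -> 'I_d -> R) :
    \sum_(p <- pairs d) G p.1 p.2 = \sum_(i < d) \sum_(j < d | (i < j)%N) G i j.
  by rewrite big_filter big_enum_cond pair_big_dep.
rewrite big_split /= (h F) (h (fun i j => F j i)).
rewrite [X in _ + X](exchange_big_dep xpredT) //= -big_split /=.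
apply: eq_bigr => i _; rewrite [RHS](bigID (fun j : 'I_d => (i < j)%N)) /=.
congr (_ + _); apply: eq_bigl => j; rewrite -val_eqE /=; first by case: ltngtP.
by case: ltngtP.
Qed.

(** This is c_s^2 / c^2, the second moment of the weights in lattice units. *)
Definition c2 : R := 2 * wax P + 4 * (d%:R - 1) * wdiag P.

Lemma avg_nil : avg (mono [::]) = 1.
Proof.
have m1 v : mono [::] v = 1 by rewrite /mono big_nil.
rewrite avgE m1 (eq_bigr (fun=> 2)) => [|j _]; last by rewrite !m1.
rewrite [X in _ + _ * X](eq_bigr (fun=> 4)) => [|p _]; last by rewrite !m1; ring.
rewrite sumr_const card_ord big_const_seq iter_addr_0.
have /(congr1 (fun n => n%:R : R)) := size_pairs d.
rewrite natrD natrM natrX => e.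
rewrite count_predT -[2 *+ d]mulr_natr -[4 *+ _]mulr_natr.
have -> : wzero d P = 1 - 2 * d%:R * wax P - 2 * (d%:R ^+ 2 - d%:R) * wdiag P.
  by rewrite /wzero; ring.
by rewrite -e; ring.
Qed.

Lemma avg2 i j : avg (mono [:: i; j]) = c2 * (i == j)%:R.
Proof.
have m2 v : mono [:: i; j] v = v 0 i * v 0 j by rewrite /mono !big_cons big_nil mulr1.
rewrite avgE.
have -> : \sum_k (mono [:: i; j] 'u_k + mono [:: i; j] (- 'u_k)) = 2 * (i == j)%:R.
  under eq_bigr => k _ do rewrite !m2 !mxE !eqxx /= mulrNN -mulr2n.
  rewrite (bigD1 i) //= eqxx big1 ?addr0 => [|k ki].
    by rewrite mul1r eq_sym mulr_natl.
  by rewrite [i == k]eq_sym (negPf ki) mul0r mul0rn.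
pose h (k : 'I_d) : R := (i == k)%:R * (j == k)%:R.
rewrite (eq_bigr (fun p : 'I_d * 'I_d => 4 * h p.1 + 4 * h p.2)) => [|p _]; last first.
  by rewrite !m2 !mxE !eqxx /= /h; ring.
rewrite (sum_pairs (fun k _ => 4 * h k)) m2 !mxE mul0r mulr0 add0r.
rewrite (bigD1 i) //= [X in _ * (_ + X)]big1 ?addr0 => [|k ki]; last first.
  by rewrite big1 // => l _; rewrite /h eq_sym (negPf ki) mul0r mulr0.
rewrite sumr_const /h eqxx mul1r [j == i]eq_sym.
have -> : #|[pred j0 | j0 != i]| = d.-1.
  by rewrite -[in RHS](card_ord d) -(cardC1 i); apply: eq_card.
have e : d%:R - 1 = d.-1%:R :> R.
  by rewrite -subn1 natrB // (leq_ltn_trans _ (ltn_ord i)).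
by rewrite /c2 e -mulr_natr; ring.
Qed.

Lemma avg22 i j : i != j -> avg (mono [:: i; i; j; j]) = 4 * wdiag P.
Proof.
move=> ij; have m4 v : mono [:: i; i; j; j] v = v 0 i ^+ 2 * v 0 j ^+ 2.
  by rewrite /mono !big_cons big_nil; ring.
have z (k : 'I_d) : (i == k)%:R * (j == k)%:R = 0 :> R.
  case: (eqVneq i k) => [<-|]; last by rewrite mul0r.
  by rewrite eq_sym (negPf ij) mulr0.
have sq (b : bool) : b%:R * b%:R = b%:R :> R by case: b; rewrite ?mulr0 ?mulr1.
rewrite avgE big1 => [|k _]; last first.
  rewrite !m4 !mxE !eqxx /= (_ : _ + _ = 2 * ((i == k)%:R * (j == k)%:R) ^+ 2); last by ring.
  by rewrite z expr0n mulr0.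
pose h (k l : 'I_d) : R := 4 * ((i == k)%:R * (j == l)%:R).
rewrite (eq_big_seq (fun p : 'I_d * 'I_d => h p.1 p.2 + h p.2 p.1)) => [|p]; last first.
  rewrite in_pairs => hp; have pn : p.1 != p.2 by rewrite -val_eqE neq_ltn hp.
  have zz (k : 'I_d) : (k == p.1)%:R * (k == p.2)%:R = 0 :> R.
    case: (eqVneq k p.1) => [->|]; last by rewrite mul0r.
    by rewrite (negPf pn) mulr0.
  (* Indicators on the right are replaced by their squares, so that the sum over the four signs
     becomes a polynomial identity modulo the vanishing products [e1], [e2], [e3]. *)
  rewrite !m4 !mxE !eqxx /= /h -[(i == p.1)%:R in RHS]sq -[(i == p.2)%:R in RHS]sq.
  rewrite -[(j == p.1)%:R in RHS]sq -[(j == p.2)%:R in RHS]sq.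
  move: (z p.1) (z p.2) (zz i) (zz j).
  move: (i == p.1)%:R (i == p.2)%:R (j == p.1)%:R (j == p.2)%:R => x y x' y' e1 e2 e3 e4.
  rewrite (_ : _ + _ = 4 * (x * x * (y' * y') + y * y * (x' * x') + (x * x') * (x * x')
    + (y * y') * (y * y') + 4 * (x * y) * (x' * y'))
    ); last by ring.
  by rewrite e1 e2 e3; ring.
rewrite sum_pairs m4 !mxE expr0n mul0r mulr0 add0r mulr0 add0r.
rewrite (bigD1 i) //= [X in _ * (_ + X)]big1 ?addr0 => [|k ki]; last first.
  by rewrite big1 // => l _; rewrite /h eq_sym (negPf ki) mul0r mulr0.
rewrite (bigD1 j) /=; last by rewrite eq_sym.
rewrite big1 => [|l /andP[_ lj]]; last by rewrite /h [j == l]eq_sym (negPf lj) !mulr0.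
by rewrite /h !eqxx /=; ring.
Qed.

Lemma avg_odd s : odd (size s) -> avg (mono s) = 0.
Proof.
move=> os; have mN v : mono s (- v) = - mono s v.
  rewrite -mulN1r -[X in X * _](_ : (-1) ^+ size s = -1); last by rewrite -signr_odd os expr1.
  elim: s {os} => [|i s IH]; first by rewrite /mono !big_nil mul1r.
  by rewrite !mono_cons IH mxE exprS; ring.
have m0 : mono s (0 : 'rV[R]_d) = 0.
  by have := mN 0; rewrite oppr0 => h; lra.
rewrite avgE m0 !big1 => [|p _|j _]; first by ring.
  by rewrite (addrC (- 'u_p.1)) -(opprB 'u_p.1 'u_p.2) -(opprD 'u_p.1 'u_p.2) !mN; ring.
by rewrite mN subrr.
Qed.

Definition c22 : R := 4 * wdiag P.

(** Isotropy would require the pure fourth moment to be 3 [c22]; since e^4 = e^2 it is [c2], and the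
    last term is the defect. It is the source of every [X4] below. *)
Lemma avg4 a b c e : avg (mono [:: a; b; c; e]) =
  c22 * ((a == b)%:R * (c == e)%:R + (a == c)%:R * (b == e)%:R + (a == e)%:R * (b == c)%:R)
  + (c2 - 3 * c22) * ((a == b)%:R * (b == c)%:R * (c == e)%:R).
Proof.
have m4 v (i j k l : 'I_d) : mono [:: i; j; k; l] v = v 0 i * v 0 j * v 0 k * v 0 l.
  by rewrite /mono !big_cons big_nil; ring.
have m2 v (i j : 'I_d) : mono [:: i; j] v = v 0 i * v 0 j.
  by rewrite /mono !big_cons big_nil; ring.
have zero f : {in lat, forall v, f v = 0} -> avg f = 0.
  by move=> h; rewrite /avg big1 // => k _; rewrite h ?evec_in ?mulr0.
have triple i j k l : i != j -> i != k -> j != k ->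
    {in lat, forall v, v 0 l * (v 0 i * v 0 j * v 0 k) = 0}.
  by move=> ij ik jk v lv; rewrite velset_triple ?mulr0.
have same i : avg (mono [:: i; i; i; i]) = c2.
  rewrite (@avg_eq _ (mono [:: i; i])) ?avg2 ?eqxx ?mulr1 // => v lv.
  rewrite m4 m2; transitivity (v 0 i ^+ 3 * v 0 i); first by ring.
  by rewrite velset_cube.
have three i j : i != j -> avg (mono [:: i; i; i; j]) = 0.
  move=> ij; rewrite (@avg_eq _ (mono [:: i; j])) ?avg2 ?(negPf ij) ?mulr0 // => v lv.
  rewrite m4 m2; transitivity (v 0 i ^+ 3 * v 0 j); first by ring.
  by rewrite velset_cube.
have perm i j k l i' j' k' l' : perm_eq [:: i; j; k; l] [:: i'; j'; k'; l'] ->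
    avg (mono [:: i; j; k; l]) = avg (mono [:: i'; j'; k'; l']).
  by move=> p; apply: avg_eq => v _; exact: perm_big.
have distinct i j k l : i != j -> i != k -> j != k -> avg (mono [:: i; j; k; l]) = 0.
  by move=> ij ik jk; apply: zero => v lv; rewrite m4 mulrC triple.
have [<-{b}|ab] := eqVneq a b.
  have [<-{c}|ac] := eqVneq a c.
    have [<-{e}|ae] := eqVneq a e; first by rewrite same /=; ring.
    by rewrite three //=; ring.
  have [<-{e}|ce] := eqVneq c e; first by rewrite avg22 //= /c22; ring.
  have [<-{e ce}|ae] := eqVneq a e.
    rewrite (perm a a c a a a a c); last by apply/permP => p /=; ring.
    by rewrite three //=; ring.
  rewrite (perm a a c e a c e a); last by apply/permP => p /=; ring.
  by rewrite distinct //=; ring.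
have [<-{c}|ac] := eqVneq a c.
  have [<-{e}|be] := eqVneq b e.
    rewrite (perm a b a b a a b b); last by apply/permP => p /=; ring.
    by rewrite avg22 //= ?(eq_sym b a) ?(negPf ab) /c22 /=; ring.
  have [<-{e be}|ae] := eqVneq a e.
    rewrite (perm a b a a a a a b); last by apply/permP => p /=; ring.
    by rewrite three //= ?(eq_sym b a) ?(negPf ab) /=; ring.
  rewrite (perm a b a e a b e a); last by apply/permP => p /=; ring.
  by rewrite distinct //= ?(eq_sym b a) ?(negPf ab) /=; ring.
have [<-{c ac}|bc] := eqVneq b c; last first.
  by rewrite distinct //= !mulr0 !mul0r; ring.
have [<-{e}|ae] := eqVneq a e.
  rewrite (perm a b b a a a b b); last by apply/permP => p /=; ring.
  by rewrite avg22 //= /c22; ring.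
have [<-{e ae}|be] := eqVneq b e.
  rewrite (perm a b b b b b b a); last by apply/permP => p /=; ring.
  by rewrite three 1?eq_sym //=; ring.
rewrite (perm a b b e a b e b); last by apply/permP => p /=; ring.
by rewrite distinct //=; ring.
Qed.

End Averages.

(** * The formal solution in symbols *)

Section Symbols.
Variables (R : realType) (d : nat) (P : params R) (c : R).
Hypotheses (c_neq0 : c != 0) (Padm : admissible d P).
Variables (B : comNzRingType) (io : {rmorphism R -> B}) (T : B) (X : 'I_d -> B).
Implicit Types (a : nat -> B) (s : seq 'I_d).

Local Notation q := (nvel d).
Local Notation e_ := (@evec R d).

(** A sequence [a] is a power series in dx whose coefficients are symbols, and [shift1] multiplies
    it by dx. The ring [B] stays abstract until the fields are brought back. *)
Definition shift1 a n := if n is m.+1 then a m else 0.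

Definition sym_dtD (E : B) a n := T * shift1 (shift1 a) n + E * shift1 a n.

Definition sym_exp (E : B) a n :=
  \sum_(1 <= m < n.+1) io (m`!%:R^-1) * iter m (sym_dtD E) a n.

Definition sym_grad (e : 'rV[R]_d) := \sum_j io (e 0 j) * X j.

Definition sym_step (F : 'I_q -> nat -> B) i n :=
  - \sum_k io (invmx (Lambda d P c) i k) * sym_exp (sym_grad (e_ k)) (F k) n.

Definition sym_feq (i : 'I_q) n := if n is 0%N then io (weight P i) else 0.

Definition sym_maxwell i n := \sum_(0 <= m < n.+1) iter m sym_step sym_feq i n.

Lemma shift1_local a b n : (forall m, (m < n)%N -> a m = b m) -> shift1 a n = shift1 b n.
Proof. by case: n => //= n; apply. Qed.

Lemma sym_dtD_local E a b n : (forall m, (m < n)%N -> a m = b m) ->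
  sym_dtD E a n = sym_dtD E b n.
Proof.
move=> ab; rewrite /sym_dtD (shift1_local ab); congr (_ * _ + _).
apply: shift1_local => m mn; apply: shift1_local => l lm.
by apply: ab; exact: ltn_trans mn.
Qed.

Lemma sym_exp_local E a b n : (forall m, (m < n)%N -> a m = b m) ->
  sym_exp E a n = sym_exp E b n.
Proof.
move=> ab; apply: eq_big_nat => m /andP[m0 _]; congr (_ * _).
case: m m0 => // m _ /=; apply: sym_dtD_local => l ln.
have {ab}: forall k, (k <= l)%N -> a k = b k.
  by move=> k kl; apply: ab; exact: leq_ltn_trans ln.
elim: m l {ln} => [|m IH] l ab; first exact: ab.
apply: sym_dtD_local => k kl; apply: IH => j jk; apply: ab.
exact: leq_trans jk (ltnW kl).
Qed.

Lemma sym_step_local F G i n : (forall k m, (m < n)%N -> F k m = G k m) ->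
  sym_step F i n = sym_step G i n.
Proof.
move=> FG; congr (- _); apply: eq_bigr => k _; congr (_ * _).
by apply: sym_exp_local => m; exact: FG.
Qed.

Lemma iter_sym_dtD_eq0 E a m n : (n < m)%N -> iter m (sym_dtD E) a n = 0.
Proof.
elim: m n => // m IH n; rewrite ltnS => nm /=; rewrite /sym_dtD.
case: n nm => [|n] nm /=; first by rewrite !mulr0 addr0.
rewrite IH // mulr0 addr0; case: n nm => [|n] nm /=; first by rewrite mulr0.
by rewrite IH ?mulr0 // ltnW.
Qed.

Section Sums.
Variables (I : Type) (r : seq I).

Lemma sym_dtD_sum E (A : I -> nat -> B) n :
  sym_dtD E (fun m => \sum_(i <- r) A i m) n = \sum_(i <- r) sym_dtD E (A i) n.
Proof.
have h (C : I -> nat -> B) m :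
    shift1 (fun l => \sum_(i <- r) C i l) m = \sum_(i <- r) shift1 (C i) m.
  by case: m => //=; rewrite big1.
rewrite big_split /= -!mulr_sumr -!h; congr (_ * _ + _).
by apply: shift1_local => m _; rewrite h.
Qed.

Lemma sym_exp_sum E (A : I -> nat -> B) n :
  sym_exp E (fun m => \sum_(i <- r) A i m) n = \sum_(i <- r) sym_exp E (A i) n.
Proof.
rewrite /sym_exp exchange_big /=; apply: eq_bigr => m _.
rewrite -mulr_sumr; congr (_ * _); elim: m n => //= m IH n.
by rewrite -sym_dtD_sum; apply: sym_dtD_local => l _; exact: IH.
Qed.

Lemma sym_step_sum (F : I -> 'I_q -> nat -> B) i n :
  sym_step (fun k m => \sum_(j <- r) F j k m) i n = \sum_(j <- r) sym_step (F j) i n.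
Proof.
rewrite /sym_step sumrN exchange_big /=; congr (- _); apply: eq_bigr => k _.
by rewrite sym_exp_sum mulr_sumr.
Qed.

End Sums.

Lemma iter_sym_step_eq0 m i n : (n < m)%N -> iter m sym_step sym_feq i n = 0.
Proof.
elim: m i n => // m IH i n; rewrite ltnS => nm /=.
(* Below order [n] the argument vanishes; written as an empty sum, it is sent to zero by the
   linearity of [sym_step]. *)
rewrite (@sym_step_local _ (fun k l => \sum_(j <- Nil nat) sym_feq k l)) => [|k l ln].
  by rewrite (sym_step_sum _ (fun=> sym_feq)) big_nil.
by rewrite big_nil IH // (leq_trans ln).
Qed.

(** The sums defining [sym_maxwell] are cut at a length depending on the order. One step reads only
    lower orders, where the extra iterates are zero, so all truncations agree. *)
Lemma sym_maxwell_fix i n : sym_maxwell i n = sym_feq i n + sym_step sym_maxwell i n.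
Proof.
rewrite {1}/sym_maxwell big_nat_recl //=; congr (_ + _).
rewrite -(sym_step_sum _ (fun m => iter m sym_step sym_feq)).
apply: sym_step_local => k l ln; rewrite /sym_maxwell (big_cat_nat (n := l.+1)) //=.
rewrite [X in _ + X](_ : _ = 0) ?addr0 // big_nat big1 // => m /andP[lm _].
exact: iter_sym_step_eq0.
Qed.

Lemma sym_maxwell0 k : sym_maxwell k 0 = io (weight P k).
Proof. by rewrite /sym_maxwell big_nat1. Qed.

(** [pe s j n] is the [dx^n] coefficient of the sum over the velocities of
    f_k times the monomial [s] of e_k times (e_k . nabla)^j. *)
Definition pe s (j n : nat) : B :=
  \sum_k io (mono s (e_ k)) * sym_grad (e_ k) ^+ j * sym_maxwell k n.

Lemma pe_grad s j n : pe s j.+1 n = \sum_l X l * pe (l :: s) j n.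
Proof.
rewrite /pe; under [RHS]eq_bigr do rewrite mulr_sumr.
rewrite exchange_big; apply: eq_bigr => k _ /=.
rewrite exprSr; move: (sym_grad (e_ k) ^+ j) => w.
rewrite /sym_grad mulrA mulr_sumr mulr_suml; apply: eq_bigr => l _.
by rewrite mono_cons rmorphM /=; ring.
Qed.

Lemma pe00 s : pe s 0 0 = io (avg P (mono s)).
Proof.
rewrite rmorph_sum; apply: eq_bigr => k _.
by rewrite sym_maxwell0 rmorphM /=; ring.
Qed.

Variables h2 h6 h24 h120 : R.
Hypotheses (h2E : h2 = 2`!%:R^-1) (h6E : h6 = 3`!%:R^-1) (h24E : h24 = 4`!%:R^-1)
  (h120E : h120 = 5`!%:R^-1).

Lemma pe_rec s r n : left_eigen P c (mono s) r ->
  pe s 0 n.+1 = - io r * \sum_k io (mono s (e_ k)) *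
                     sym_exp (sym_grad (e_ k)) (sym_maxwell k) n.+1.
Proof.
move=> hr; rewrite mulNr mulr_sumr /pe.
under eq_bigr => i _ do rewrite expr0 mulr1 sym_maxwell_fix add0r /sym_step mulrN mulr_sumr.
rewrite sumrN exchange_big; congr (- _); apply: eq_bigr => k _ /=.
rewrite mulrA -rmorphM -hr rmorph_sum mulr_suml; apply: eq_bigr => i _.
by rewrite rmorphM mulrA.
Qed.

Lemma sym_exp1 E a : sym_exp E a 1 = E * a 0%N.
Proof.
rewrite /sym_exp /index_iota /= !big_cons big_nil /sym_dtD /shift1 /= invr1 rmorph1; ring.
Qed.

(** The factors of [a] here and in the next orders are the coefficients of exp(dx E + dx^2 T);
    multipliers such as [3 * io h6] count the arrangements of E and T within one power. *)
Lemma sym_exp2 E a : sym_exp E a 2 = E * a 1%N + (io h2 * E ^+ 2 + T) * a 0%N.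
Proof.
rewrite /sym_exp /index_iota /= !big_cons big_nil -h2E /sym_dtD /shift1 /= invr1 rmorph1; ring.
Qed.

Lemma sym_exp3 E a : sym_exp E a 3 = E * a 2%N + (io h2 * E ^+ 2 + T) * a 1%N
  + (io h6 * E ^+ 3 + 2 * io h2 * T * E) * a 0%N.
Proof.
rewrite /sym_exp /index_iota /= !big_cons big_nil -h2E -h6E /sym_dtD /shift1 /= invr1 rmorph1; ring.
Qed.

Lemma sym_exp4 E a : sym_exp E a 4 = E * a 3%N + (io h2 * E ^+ 2 + T) * a 2%N
  + (io h6 * E ^+ 3 + 2 * io h2 * T * E) * a 1%N
  + (io h24 * E ^+ 4 + 3 * io h6 * T * E ^+ 2 + io h2 * T ^+ 2) * a 0%N.
Proof.
rewrite /sym_exp /index_iota /= !big_cons big_nil -h2E -h6E -h24E /sym_dtD /shift1 /=.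
by rewrite invr1 rmorph1; ring.
Qed.

Lemma sym_exp5 E a : sym_exp E a 5 = E * a 4%N + (io h2 * E ^+ 2 + T) * a 3%N
  + (io h6 * E ^+ 3 + 2 * io h2 * T * E) * a 2%N
  + (io h24 * E ^+ 4 + 3 * io h6 * T * E ^+ 2 + io h2 * T ^+ 2) * a 1%N
  + (io h120 * E ^+ 5 + 4 * io h24 * T * E ^+ 3 + 3 * io h6 * T ^+ 2 * E) * a 0%N.
Proof.
rewrite /sym_exp /index_iota /= !big_cons big_nil -h2E -h6E -h24E -h120E /sym_dtD /shift1 /=.
by rewrite invr1 rmorph1; ring.
Qed.

Lemma pe1 s r : left_eigen P c (mono s) r -> pe s 0 1 = - io r * pe s 1 0.
Proof.
move=> hr; rewrite (pe_rec _ hr); congr (_ * _); apply: eq_bigr => k _.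
by rewrite sym_exp1; ring.
Qed.

Lemma pe2 s r : left_eigen P c (mono s) r ->
  pe s 0 2 = - io r * (pe s 1 1 + io h2 * pe s 2 0 + T * pe s 0 0).
Proof.
move=> hr; rewrite (pe_rec _ hr); congr (_ * _).
rewrite /pe !mulr_sumr -!big_split; apply: eq_bigr => k _ /=.
by rewrite sym_exp2; ring.
Qed.

Lemma pe3 s r : left_eigen P c (mono s) r ->
  pe s 0 3 = - io r * (pe s 1 2 + io h2 * pe s 2 1 + T * pe s 0 1
    + io h6 * pe s 3 0 + 2 * io h2 * T * pe s 1 0).
Proof.
move=> hr; rewrite (pe_rec _ hr); congr (_ * _).
rewrite /pe !mulr_sumr -!big_split; apply: eq_bigr => k _ /=.
by rewrite sym_exp3; ring.
Qed.

Lemma pe4 s r : left_eigen P c (mono s) r ->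
  pe s 0 4 = - io r * (pe s 1 3 + io h2 * pe s 2 2 + T * pe s 0 2
    + io h6 * pe s 3 1 + 2 * io h2 * T * pe s 1 1
    + io h24 * pe s 4 0 + 3 * io h6 * T * pe s 2 0 + io h2 * T ^+ 2 * pe s 0 0).
Proof.
move=> hr; rewrite (pe_rec _ hr); congr (_ * _).
rewrite /pe !mulr_sumr -!big_split; apply: eq_bigr => k _ /=.
by rewrite sym_exp4; ring.
Qed.

Lemma pe5 s r : left_eigen P c (mono s) r ->
  pe s 0 5 = - io r * (pe s 1 4 + io h2 * pe s 2 3 + T * pe s 0 3
    + io h6 * pe s 3 2 + 2 * io h2 * T * pe s 1 2
    + io h24 * pe s 4 1 + 3 * io h6 * T * pe s 2 1 + io h2 * T ^+ 2 * pe s 0 1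
    + io h120 * pe s 5 0 + 4 * io h24 * T * pe s 3 0 + 3 * io h6 * T ^+ 2 * pe s 1 0).
Proof.
move=> hr; rewrite (pe_rec _ hr); congr (_ * _).
rewrite /pe !mulr_sumr -!big_split; apply: eq_bigr => k _ /=.
by rewrite sym_exp5; ring.
Qed.

Lemma pe_parity_grad n : (forall s, odd (size s + n) -> pe s 0 n = 0) ->
  forall j s, odd (size s + j + n) -> pe s j n = 0.
Proof.
move=> h; elim=> [|j IH] s; first by rewrite addn0; exact: h.
move=> o; rewrite pe_grad big1 // => l _; rewrite IH ?mulr0 //.
by move: o; rewrite !oddD /= addNb addbN.
Qed.

(** A factor E costs one order of dx and T costs two, so the recursion preserves the parity of
    degree plus order; it ends in odd moments of the weights, which vanish. *)
Lemma pe_parity s n : (n <= 5)%N -> odd (size s + n) -> pe s 0 n = 0.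
Proof.
have z0 t : odd (size t + 0) -> pe t 0 0 = 0.
  by rewrite addn0 => o; rewrite pe00 avg_odd // rmorph0.
(* In the recursion for order [k] the terms are [pe t j m] with j + m congruent to [k] modulo 2; the
   statement is put in the form in which these terms arise. *)
have gen m : (forall t, odd (size t + m) -> pe t 0 m = 0) ->
    forall t k, odd (size t + k) -> forall j, ~~ odd (j + k + m) -> pe t j m = 0.
  move=> z t k ok j jkm; apply: pe_parity_grad z _ _ _.
  by move: ok jkm; rewrite !oddD; case: (odd (size t)); case: (odd j); case: (odd k); case: (odd m).
have Z0 := gen _ z0.
have z1 t : odd (size t + 1) -> pe t 0 1 = 0.
  move=> o; have [r hr] := eigen_exists Padm c_neq0 t.
  by rewrite (pe1 hr) !(Z0 _ _ o) // mulr0.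
have Z1 := gen _ z1.
have z2 t : odd (size t + 2) -> pe t 0 2 = 0.
  move=> o; have [r hr] := eigen_exists Padm c_neq0 t.
  by rewrite (pe2 hr) !(Z0 _ _ o, Z1 _ _ o) // !mulr0 !addr0 mulr0.
have Z2 := gen _ z2.
have z3 t : odd (size t + 3) -> pe t 0 3 = 0.
  move=> o; have [r hr] := eigen_exists Padm c_neq0 t.
  by rewrite (pe3 hr) !(Z0 _ _ o, Z1 _ _ o, Z2 _ _ o) // !mulr0 !addr0 mulr0.
have Z3 := gen _ z3.
have z4 t : odd (size t + 4) -> pe t 0 4 = 0.
  move=> o; have [r hr] := eigen_exists Padm c_neq0 t.
  by rewrite (pe4 hr) !(Z0 _ _ o, Z1 _ _ o, Z2 _ _ o, Z3 _ _ o) // !mulr0 !addr0 mulr0.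
have Z4 := gen _ z4.
have z5 t : odd (size t + 5) -> pe t 0 5 = 0.
  move=> o; have [r hr] := eigen_exists Padm c_neq0 t.
  by rewrite (pe5 hr) !(Z0 _ _ o, Z1 _ _ o, Z2 _ _ o, Z3 _ _ o, Z4 _ _ o) // !mulr0 !addr0 mulr0.
by case: n => [|[|[|[|[|[|]]]]]] // _;
  [exact: z0|exact: z1|exact: z2|exact: z3|exact: z4|exact: z5].
Qed.

(** * Explicit moments of the formal solution *)

Definition delta (i j : 'I_d) : B := io (i == j)%:R.

Lemma delta_neq i j : i != j -> delta i j = 0.
Proof. by rewrite /delta => /negPf->; rewrite rmorph0. Qed.

Lemma delta_eq i : delta i i = 1.
Proof. by rewrite /delta eqxx rmorph1. Qed.

Lemma contract_delta i (f : 'I_d -> B) : \sum_l X l * (delta l i * f l) = X i * f i.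
Proof.
rewrite (bigD1 i) //= delta_eq mul1r big1 ?addr0 // => l li.
by rewrite delta_neq // mul0r mulr0.
Qed.

Definition X2 := \sum_l X l ^+ 2.
Definition X4 := \sum_l X l ^+ 4.

(** An isotropic part plus a part supported on equal indices. The shapes [tensor3], [tensor2],
    [tensor1] are carried into each other by contraction with [X], so the recursion only has to
    track coefficients. *)
Definition tensor3 (al be : B) i j k :=
  al * (delta j k * X i + delta i k * X j + delta i j * X k) + be * delta i j * delta j k * X i.

Definition tensor2 (al k1 k3 kT : B) i j :=
  al * X i * X j + delta i j * (k1 * X2 + k3 * X i ^+ 2 + kT).

Definition tensor1 (al k3 kT : B) i := al * X i * X2 + k3 * X i ^+ 3 + kT * X i.

Lemma contract_tensor3 al be i j :
  \sum_l X l * tensor3 al be l i j = tensor2 (2 * al) al be 0 i j.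
Proof.
transitivity (\sum_l (al * delta i j * X l ^+ 2
  + al * X i * (X l * (delta l j * 1)) + al * X j * (X l * (delta l i * 1))
  + be * delta i j * (X l * (delta l i * X l)))).
  by apply: eq_bigr => l _; rewrite /tensor3; ring.
by rewrite !big_split /= -!mulr_sumr !contract_delta -/X2 /tensor2; ring.
Qed.

Lemma contract_tensor2 al k1 k3 kT i :
  \sum_l X l * tensor2 al k1 k3 kT l i = tensor1 (al + k1) k3 kT i.
Proof.
transitivity (\sum_l (al * X i * X l ^+ 2
  + X l * (delta l i * (k1 * X2 + k3 * X l ^+ 2 + kT)))).
  by apply: eq_bigr => l _; rewrite /tensor2; ring.
by rewrite !big_split /= -!mulr_sumr !contract_delta -/X2 /tensor1; ring.
Qed.

Lemma contract_tensor1 al k3 kT :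
  \sum_l X l * tensor1 al k3 kT l = al * X2 ^+ 2 + k3 * X4 + kT * X2.
Proof.
transitivity (\sum_l (al * X2 * X l ^+ 2 + k3 * X l ^+ 4 + kT * X l ^+ 2)).
  by apply: eq_bigr => l _; rewrite /tensor1; ring.
by rewrite !big_split /= -!mulr_sumr -/X2 -/X4; ring.
Qed.

Local Notation k2 := (c2 d P).
Local Notation k22 := (c22 P).
Local Notation r0 := (s0 P)^-1.
Local Notation r1 := (s1 P)^-1.
Local Notation r21 := (s21 P)^-1.
Local Notation r22 := (s22 P)^-1.

(** In these names the digits are the length of the monomial, the power of (e . X) and the order in
    dx; a missing third digit means order 0. *)
Lemma pe_2_0 i j : pe [:: i; j] 0 0 = io k2 * delta i j.
Proof. by rewrite pe00 avg2 rmorphM. Qed.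

Lemma pe_1_1 i : pe [:: i] 1 0 = io k2 * X i.
Proof.
rewrite pe_grad; transitivity (\sum_l X l * (delta l i * io k2)).
  by apply: eq_bigr => l _; rewrite pe_2_0; ring.
by rewrite contract_delta mulrC.
Qed.

Lemma pe_0_2 : pe [::] 2 0 = io k2 * X2.
Proof.
rewrite pe_grad mulr_sumr; apply: eq_bigr => l _; rewrite pe_1_1; ring.
Qed.

Lemma pe_3_1 i j k : pe [:: i; j; k] 1 0 = tensor3 (io k22) (io (k2 - 3 * k22)) i j k.
Proof.
rewrite pe_grad; transitivity (\sum_l (io k22 * delta j k * (X l * (delta l i * 1))
   + io k22 * delta i k * (X l * (delta l j * 1)) + io k22 * delta i j * (X l * (delta l k * 1))
   + io (k2 - 3 * k22) * delta i j * delta j k * (X l * (delta l i * 1)))).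
  apply: eq_bigr => l _; rewrite pe00 avg4 rmorphD !(rmorphM io) !(rmorphD io) !(rmorphM io) /=.
  by rewrite -!/(delta _ _); ring.
by rewrite !big_split /= -!mulr_sumr !contract_delta /tensor3; ring.
Qed.

Lemma pe_2_2 i j : pe [:: i; j] 2 0 =
  tensor2 (2 * io k22) (io k22) (io (k2 - 3 * k22)) 0 i j.
Proof.
rewrite pe_grad; under eq_bigr do rewrite pe_3_1.
exact: contract_tensor3.
Qed.

Lemma pe_1_3 i : pe [:: i] 3 0 = tensor1 (3 * io k22) (io (k2 - 3 * k22)) 0 i.
Proof.
rewrite pe_grad; under eq_bigr do rewrite pe_2_2.
by rewrite contract_tensor2; congr tensor1; ring.
Qed.

Lemma pe_0_4 : pe [::] 4 0 = 3 * io k22 * X2 ^+ 2 + io (k2 - 3 * k22) * X4.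
Proof.
rewrite pe_grad; under eq_bigr do rewrite pe_1_3.
by rewrite contract_tensor1; ring.
Qed.

Lemma eigen_one (i : 'I_d) : left_eigen P c (mono [:: i]) r1.
Proof.
apply: (eigen_pow Padm c_neq0 (i := i) (a := false)) => v _.
by rewrite /mono big_seq1.
Qed.

Lemma eigen_cube (i : 'I_d) : left_eigen P c (mono [:: i; i; i]) r1.
Proof.
apply: (eigen_pow Padm c_neq0 (i := i) (a := false)) => v lv.
by rewrite -[RHS](velset_cube i lv) /mono !big_cons big_nil; ring.
Qed.

Lemma eigen_sqr (i : 'I_d) : left_eigen P c (mono [:: i; i]) r21.
Proof.
apply: (eigen_pow Padm c_neq0 (i := i) (a := true)) => v lv.
by rewrite /mono !big_cons big_nil; ring.
Qed.

Lemma eigen_mixed (i j : 'I_d) : i != j -> left_eigen P c (mono [:: i; j]) r22.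
Proof.
move=> ij; apply: (eigen_pair Padm c_neq0 (a := false) (b := false) ij) => v lv.
by rewrite /mono !big_cons big_nil; ring.
Qed.

Lemma pe_1_0_1 i : pe [:: i] 0 1 = - io (r1 * k2) * X i.
Proof. by rewrite (pe1 (eigen_one i)) pe_1_1 rmorphM; ring. Qed.

(** A pure cube equals e_i on the lattice and relaxes with [s1], while the mixed cubic moments relax
    with rate 1; hence [r1] appears only in the part with all indices equal. *)
Lemma pe_3_0_1 i j k :
  pe [:: i; j; k] 0 1 = tensor3 (- io k22) (- io (r1 * k2 - 3 * k22)) i j k.
Proof.
have two l m (t : seq 'I_d) : l != m -> perm_eq t [:: l; l; m] -> left_eigen P c (mono t) 1.
  move=> lm tl; apply: (eigen_pair Padm c_neq0 (a := true) (b := false) lm) => v _.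
  by rewrite /mono (perm_big _ tl) !big_cons big_nil /=; ring.
have [<-{j}|ij] := eqVneq i j.
  have [<-{k}|ik] := eqVneq i k.
    by rewrite (pe1 (eigen_cube i)) pe_3_1 /tensor3 !delta_eq; ring.
  rewrite (pe1 (two i k _ ik _)) // pe_3_1 /tensor3 !delta_eq !(delta_neq ik); ring.
have [<-{k}|ik] := eqVneq i k.
  rewrite (pe1 (two i j _ ij _)); last by apply/permP => p /=; ring.
  by rewrite pe_3_1 /tensor3 !delta_eq !(delta_neq ij); ring.
have [<-{k ik}|jk] := eqVneq j k.
  have ji : j != i by rewrite eq_sym.
  rewrite (pe1 (two j i _ ji _)); last by apply/permP => p /=; ring.
  by rewrite pe_3_1 /tensor3 !delta_eq !(delta_neq ij); ring.
(* The monomial is zero on the lattice, so any eigenvalue is admissible; 0 makes the right-hand side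
   vanish. *)
rewrite (@pe1 _ 0); last first.
  apply: eigen_zero => v lv; rewrite -(velset_triple lv ij ik jk).
  by rewrite /mono !big_cons big_nil; ring.
by rewrite /tensor3 (delta_neq ij) (delta_neq ik) (delta_neq jk) rmorph0; ring.
Qed.

Lemma pe_0_1_1 : pe [::] 1 1 = - io (r1 * k2) * X2.
Proof.
by rewrite pe_grad mulr_sumr; apply: eq_bigr => l _; rewrite pe_1_0_1; ring.
Qed.

Lemma pe_2_1_1 i j : pe [:: i; j] 1 1 =
  tensor2 (- 2 * io k22) (- io k22) (- io (r1 * k2 - 3 * k22)) 0 i j.
Proof.
rewrite pe_grad; under eq_bigr do rewrite pe_3_0_1.
by rewrite contract_tensor3; congr tensor2; ring.
Qed.

Lemma pe_1_2_1 i : pe [:: i] 2 1 = tensor1 (- 3 * io k22) (- io (r1 * k2 - 3 * k22)) 0 i.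
Proof.
rewrite pe_grad; under eq_bigr do rewrite pe_2_1_1.
by rewrite contract_tensor2; congr tensor1; ring.
Qed.

Lemma pe_0_3_1 : pe [::] 3 1 = - 3 * io k22 * X2 ^+ 2 - io (r1 * k2 - 3 * k22) * X4.
Proof.
rewrite pe_grad; under eq_bigr do rewrite pe_1_2_1.
by rewrite contract_tensor1; ring.
Qed.

(** In the coefficients below, the digit is the order in dx; [a] and [b] belong to
    products with [X2] (and to mixed monomials), [g] to the pure powers of the [X i],
    [t] to the time derivative. *)
Definition a2 : R := 2 * r22 * (1 - h2) * k22.
Definition b2 : R := r21 * (1 - h2) * k22.
Definition g2 : R := - r21 * (2 * (h2 - 1) * k22 + h2 * (k2 - 3 * k22) - (r1 * k2 - 3 * k22)) - a2.

(** Off the diagonal the rate is [s22], which fixes [a2]; on it the rate is [s21]. There [a2]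
    contributes to X_i^2 as well, whence its subtraction in [g2]. *)
Lemma pe_2_0_2 i j : pe [:: i; j] 0 2 =
  tensor2 (io a2) (io b2) (io g2) (- io (r21 * k2) * T) i j.
Proof.
have [<-{j}|ij] := eqVneq i j.
  rewrite (pe2 (eigen_sqr i)) pe_2_1_1 pe_2_2 pe_2_0 /tensor2 !delta_eq /g2 /a2 /b2; ring.
by rewrite (pe2 (eigen_mixed ij)) pe_2_1_1 pe_2_2 pe_2_0 /tensor2 (delta_neq ij) /a2; ring.
Qed.

Lemma pe_1_1_2 i : pe [:: i] 1 2 = tensor1 (io (a2 + b2)) (io g2) (- io (r21 * k2) * T) i.
Proof.
rewrite pe_grad; under eq_bigr do rewrite pe_2_0_2.
by rewrite contract_tensor2; congr tensor1; exact: esym (rmorphD _ _ _).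
Qed.

Lemma pe_0_2_2 : pe [::] 2 2 =
  io (a2 + b2) * X2 ^+ 2 + io g2 * X4 - io (r21 * k2) * T * X2.
Proof.
rewrite pe_grad; under eq_bigr do rewrite pe_1_1_2.
by rewrite contract_tensor1; ring.
Qed.

Definition a3 : R := - r1 * (a2 + b2 - 3 * h2 * k22 + 3 * h6 * k22).
Definition g3 : R := - r1 * (g2 - h2 * (r1 * k2 - 3 * k22) + h6 * (k2 - 3 * k22)).
Definition t3 : R := - r1 * k2 * (2 * h2 - r1 - r21).

Lemma pe_1_0_3 i : pe [:: i] 0 3 = tensor1 (io a3) (io g3) (io t3 * T) i.
Proof.
rewrite (pe3 (eigen_one i)) pe_1_1_2 pe_1_2_1 pe_1_0_1 pe_1_3 pe_1_1 /tensor1 /a3 /g3 /t3; ring.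
Qed.

Lemma pe_0_1_3 : pe [::] 1 3 = io a3 * X2 ^+ 2 + io g3 * X4 + io t3 * T * X2.
Proof.
rewrite pe_grad; under eq_bigr do rewrite pe_1_0_3.
by rewrite contract_tensor1; ring.
Qed.

Lemma pe_0_0_0 : pe [::] 0 0 = 1.
Proof. by rewrite pe00 avg_nil rmorph1. Qed.

Lemma pe_0_0_2 : pe [::] 0 2 = - io r0 * (T - io ((r1 - h2) * k2) * X2).
Proof.
by rewrite (pe2 (eigen_nil Padm c_neq0)) pe_0_1_1 pe_0_2 pe_0_0_0; ring.
Qed.

Definition a4 : R := a3 + h2 * (a2 + b2) - 3 * h6 * k22 + 3 * h24 * k22.
Definition g4 : R := g3 + h2 * g2 - h6 * (r1 * k2 - 3 * k22) + h24 * (k2 - 3 * k22).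
Definition t4 : R := t3 - h2 * r21 * k2 - 2 * h2 * r1 * k2 + 3 * h6 * k2
  + r0 * (r1 - h2) * k2.

Lemma pe_0_0_4 : pe [::] 0 4 = - io r0 * (io a4 * X2 ^+ 2 + io g4 * X4
  + io t4 * T * X2 + io (h2 - r0) * T ^+ 2).
Proof.
rewrite (pe4 (eigen_nil Padm c_neq0)) pe_0_1_3 pe_0_2_2 pe_0_0_2 pe_0_3_1 pe_0_1_1 pe_0_4.
by rewrite pe_0_2 pe_0_0_0 /a4 /g4 /t4; ring.
Qed.

End Symbols.

(** * Consequences of the conditions on the parameters *)

Section Coefficients.
Variables (R : realType) (d : nat) (P : params R) (eps : R).
Hypotheses (Padm : admissible d P) (Pcond : conditions d eps P).

Local Notation k2 := (c2 d P).
Local Notation k22 := (c22 P).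
Local Notation h2 := (2^-1 : R).
Local Notation h6 := (6^-1 : R).
Local Notation h24 := (24^-1 : R).
Local Notation r0 := (s0 P)^-1.
Local Notation r1 := (s1 P)^-1.

Lemma rates_neq0 : [/\ s0 P != 0, s1 P != 0, s21 P != 0 & 2 - s1 P != 0].
Proof.
case: Padm => /andP[h0 _] /andP[h1 h1'] /andP[h21 _] _.
by split; rewrite gt_eqF // subr_gt0.
Qed.

(** For d = 1 the factor d - 1 removes the diagonal weight, and [Rd1], [Cond1] become [R1],
    [Con1]. *)
Lemma conditions_unified :
  [/\ eps = (r1 - h2) * k2, Rd1 d (wax P) (wdiag P) (s1 P) (s21 P) = 0,
      Cond1 d (wax P) (wdiag P) (s1 P) (s21 P) = 0
    & (1 < d)%N -> Rd2 d (wax P) (wdiag P) (s1 P) (s21 P) (s22 P) = 0 /\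
                   Cond2 d (wax P) (wdiag P) (s1 P) (s21 P) (s22 P) = 0].
Proof.
have [_ n1 _ _] := rates_neq0; move: Pcond; rewrite /conditions; case: eqP => [d1|/eqP dn1] [].
  rewrite d1 => -> e2 e3; split=> //.
  - by rewrite /xi /c2 /=; field; rewrite n1.
  - by rewrite -[RHS]e2 /Rd1 /R1; ring.
  by rewrite -[RHS]e3 /Cond1 /Con1; ring.
move=> -> e2 e3 e4 e5; split=> //.
by rewrite /xi /c2 /=; field; rewrite n1.
Qed.

Lemma c2_neq0 : 0 < eps -> k2 != 0.
Proof.
move=> eps_gt0; have [e _ _ _] := conditions_unified.
by apply: contraTneq eps_gt0 => k0; rewrite e k0 mulr0 ltxx.
Qed.

(** Putting T = eps [X2] in the third-order first moment leaves (a3 + eps t3) X_i X2 + g3 X_i^3. In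
    one dimension the two monomials coincide and only this sum counts. *)
Lemma third_order_sum : a3 P h2 h6 + g3 d P h2 h6 + eps * t3 d P h2 = 0.
Proof.
have [e _ e3 _] := conditions_unified; have [n0 n1 n21 nn] := rates_neq0.
have key : 6 * s1 P ^+ 3 * s21 P * (a3 P h2 h6 + g3 d P h2 h6 + eps * t3 d P h2)
    = Cond1 d (wax P) (wdiag P) (s1 P) (s21 P) * k2.
  rewrite e /Cond1 /a3 /g3 /t3 /g2 /a2 /b2 /c2 /c22 /=.
  (* [s22] enters through [a2], which cancels between [a3] and [g3]. Its inverse is made a free
     variable, because for d = 1 nothing says that [s22] is nonzero. *)
  by move: (s22 P)^-1 => r22; field; rewrite n1 n21.
apply: (mulfI (x := 6 * s1 P ^+ 3 * s21 P)); first by rewrite !mulf_neq0 ?expf_neq0 ?pnatr_eq0.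
by rewrite key e3 ?mul0r ?mulr0 ?mul0r.
Qed.

(** The same substitution at order four. The terms in [r0] cancel because eps = (r1 - h2) [c2], so
    [s0] is absent from the resulting condition. *)
Lemma fourth_order_sum : a4 P h2 h6 h24 + g4 d P h2 h6 h24
  + eps * t4 d P h2 h6 + eps ^+ 2 * (h2 - r0) = 0.
Proof.
have [e e2 _ _] := conditions_unified; have [n0 n1 n21 nn] := rates_neq0.
have key : 24 * s1 P ^+ 3 * s21 P * (a4 P h2 h6 h24 + g4 d P h2 h6 h24
  + eps * t4 d P h2 h6 + eps ^+ 2 * (h2 - r0))
    = Rd1 d (wax P) (wdiag P) (s1 P) (s21 P) * (2 - s1 P) * k2.
  rewrite e /Rd1 /a4 /g4 /t4 /a3 /g3 /t3 /g2 /a2 /b2 /c2 /c22 /=.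
  by move: (s22 P)^-1 => r22; field; rewrite n0 n1 n21.
apply: (mulfI (x := 24 * s1 P ^+ 3 * s21 P)); first by rewrite !mulf_neq0 ?expf_neq0 ?pnatr_eq0.
by rewrite key e2 ?mul0r ?mulr0 ?mul0r.
Qed.

Hypothesis d_gt1 : (1 < d)%N.

(** For d > 1 the coefficient of X_i X2 is made to vanish by itself; together with [third_order_sum]
    this forces [g3] = 0. *)
Lemma third_order_mixed : a3 P h2 h6 + eps * t3 d P h2 = 0.
Proof.
have [e _ _ /(_ d_gt1)[_ e5]] := conditions_unified; have [n0 n1 n21 nn] := rates_neq0.
have n22 : s22 P != 0 by case: Padm => _ _ _ /(_ d_gt1) /andP[h _]; rewrite gt_eqF.
have key : s1 P ^+ 3 * s21 P * s22 P * (a3 P h2 h6 + eps * t3 d P h2)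
    = 2 * Cond2 d (wax P) (wdiag P) (s1 P) (s21 P) (s22 P).
  rewrite e /Cond2 /a3 /t3 /a2 /b2 /c2 /c22 /=; field.
  by rewrite n1 n21 n22.
apply: (mulfI (x := s1 P ^+ 3 * s21 P * s22 P)).
  by rewrite !mulf_neq0 ?expf_neq0 ?pnatr_eq0.
by rewrite key e5 ?mul0r ?mulr0 ?mul0r.
Qed.

Lemma fourth_order_mixed :
  a4 P h2 h6 h24 + eps * t4 d P h2 h6 + eps ^+ 2 * (h2 - r0) = 0.
Proof.
have [e _ _ /(_ d_gt1)[e5 _]] := conditions_unified; have [n0 n1 n21 nn] := rates_neq0.
have n22 : s22 P != 0 by case: Padm => _ _ _ /(_ d_gt1) /andP[h _]; rewrite gt_eqF.
have key : 2 * s1 P ^+ 3 * s21 P * s22 P *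
    (a4 P h2 h6 h24 + eps * t4 d P h2 h6 + eps ^+ 2 * (h2 - r0))
    = Rd2 d (wax P) (wdiag P) (s1 P) (s21 P) (s22 P).
  rewrite e /Rd2 /a4 /t4 /a3 /t3 /a2 /b2 /c2 /c22 /=; field.
  by rewrite n0 n1 n21 n22.
apply: (mulfI (x := 2 * s1 P ^+ 3 * s21 P * s22 P)).
  by rewrite !mulf_neq0 ?expf_neq0 ?pnatr_eq0.
by rewrite key e5 ?mul0r ?mulr0 ?mul0r.
Qed.

End Coefficients.

(** * The explicit weights and relaxation parameters *)

Section Explicit.
Variables (R : realType) (eps : R).
Local Notation S1 := (2 / (6 * eps + 1)).
Local Notation S2 := (24 * eps / (6 * eps + 1) ^+ 2).
Local Notation S22 := (4 / (6 * eps + 3)).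

Lemma explicit_admissible : 0 < eps -> [/\ 0 < S1 < 2, 0 < S2 < 2 & 0 < S22 < 2].
Proof.
move=> e0; have p1 : 0 < 6 * eps + 1 by lra.
have p3 : 0 < 6 * eps + 3 by lra.
have p2 : 0 < (6 * eps + 1) ^+ 2 by rewrite exprn_gt0.
split; apply/andP; split; rewrite ?divr_gt0 ?ltr_pdivrMr //; try lra; nra.
Qed.

Lemma explicit_system1 : 0 < eps -> system1 eps (1 / 6) S1 S2.
Proof.
move=> e0; have p1 : 6 * eps + 1 != 0 by rewrite gt_eqF //; lra.
by split; rewrite /xi /R1 /Con1; field.
Qed.

Lemma explicit_systemd d : 0 < eps ->
  systemd d eps (1 / 6 - (d%:R - 1) * eps / 3) (eps / 6) S1 S2 S22.
Proof.
move=> e0; have p1 : 6 * eps + 1 != 0 by rewrite gt_eqF //; lra.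
have p3 : 6 * eps + 3 != 0 by rewrite gt_eqF //; lra.
split; rewrite /xi /Rd1 /Rd2 /Cond1 /Cond2; field; rewrite ?p1 ?p3 //.
Qed.

End Explicit.

(** * From symbols to fields *)

Section Realization.
Variables (R : realType) (d : nat) (theta : dxseries R d).
Hypothesis theta_smooth : smooth_series theta.

Local Notation B := (mpoly.mpoly d.+1 R).
Local Notation io := (@mpoly.mpolyC d.+1 R : {rmorphism R -> B}).

Definition dvar (i : 'I_d.+1) : B := mpoly.mpolyX R (mpoly.mnm1 i).

(** The Cauchy product of a series of operators with the formal series [theta]. *)
Definition realize (a : nat -> B) : dxseries R d :=
  fun n z => \sum_(j < n.+1) act (a j) (theta (n - j)%N) z.

Lemma eq_realize a b n : (forall j, (j <= n)%N -> a j = b j) -> realize a n = realize b n.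
Proof.
by move=> ab; apply/funext => z; apply: eq_bigr => j _; rewrite ab // -ltnS.
Qed.

Lemma realizeD a b n z : realize (fun m => a m + b m) n z = realize a n z + realize b n z.
Proof. by rewrite -big_split; apply: eq_bigr => j _; rewrite actD. Qed.

Lemma realize_scale (x : R) a n z : realize (fun m => io x * a m) n z = x * realize a n z.
Proof.
by rewrite mulr_sumr; apply: eq_bigr => j _; rewrite /= mpoly.mul_mpolyC actZ.
Qed.

Lemma realize_sum (I : Type) (r : seq I) (A : I -> nat -> B) n z :
  realize (fun m => \sum_(i <- r) A i m) n z = \sum_(i <- r) realize (A i) n z.
Proof. by rewrite exchange_big; apply: eq_bigr => j _; rewrite act_sum. Qed.

Lemma smooth_sum (I : Type) (r : seq I) (F : I -> field R d) :
  (forall i, smooth (F i)) -> smooth (fun z => \sum_(i <- r) F i z).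
Proof.
move=> sF; elim: r => [|i r IH].
  rewrite (_ : (fun _ => _) = fun=> 0); first exact: smooth0.
  by apply/funext => z; rewrite big_nil.
rewrite (_ : (fun _ => _) = fun z => 1 * F i z + \sum_(j <- r) F j z).
  exact: (smooth_lin 1 (sF i) IH).
by apply/funext => z; rewrite big_cons mul1r.
Qed.

Lemma pd_sum a (I : Type) (r : seq I) (F : I -> field R d) :
  (forall i, smooth (F i)) ->
  pd a (fun z => \sum_(i <- r) F i z) = fun z => \sum_(i <- r) pd a (F i) z.
Proof.
move=> sF; elim: r => [|i r IH].
  rewrite (_ : (fun _ => _) = fun=> 0).
    by rewrite -[LHS]/(iter_partial [:: a] _) iter_partial0; apply/funext => z; rewrite big_nil.
  by apply/funext => z; rewrite big_nil.
rewrite (_ : (fun _ => _) = fun z => 1 * F i z + \sum_(j <- r) F j z).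
  rewrite -[LHS]/(iter_partial [:: a] _) iter_partial_lin //; last exact: smooth_sum.
  apply/funext => z; rewrite big_cons mul1r; congr (_ + _).
  exact: (congr1 (fun f : field R d => f z) IH).
by apply/funext => z; rewrite big_cons mul1r.
Qed.

Lemma realize_var i a n : realize (fun m => dvar i * a m) n = pd (unlift ord0 i) (realize a n).
Proof.
rewrite /realize pd_sum => [|j]; last exact: smooth_act.
by apply/funext => z; apply: eq_bigr => j _; rewrite actM // act_var.
Qed.

Lemma mul_dx_realize a : mul_dx (realize a) = realize (shift1 a).
Proof.
apply/funext => -[|n]; apply/funext => z.
  by rewrite /realize big_ord1 act0.
by rewrite /realize [RHS]big_ord_recl act0 add0r; apply: eq_bigr => j _.
Qed.

Section Step.
Variables (P : params R) (dx dt : R).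

Local Notation eta := (dt / dx ^+ 2).
Local Notation c := (dx / dt).

Definition sT : B := io eta * dvar ord0.
Definition sX (j : 'I_d) : B := dvar (lift ord0 j).

Lemma dtD_realize e a : dtD eta e (realize a) = realize (sym_dtD sT (sym_grad io sX e) a).
Proof.
apply/funext => n; apply/funext => z.
rewrite /dtD !mul_dx_realize /sym_dtD realizeD; congr (_ + _).
  rewrite (_ : (fun m => _) = fun m => io eta * (dvar ord0 * shift1 (shift1 a) m)).
    by rewrite realize_scale realize_var unlift_none.
  by apply/funext => m; rewrite mulrA.
rewrite (_ : (fun m => _) = fun m => \sum_j io (e 0 j) * (sX j * shift1 a m)).
  rewrite realize_sum; apply: eq_bigr => j _.
  by rewrite realize_scale realize_var liftK.
by apply/funext => m; rewrite mulr_suml; apply: eq_bigr => j _; rewrite mulrA.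
Qed.

Lemma iter_dtD_realize e a m :
  iter m (dtD eta e) (realize a) = realize (iter m (sym_dtD sT (sym_grad io sX e)) a).
Proof. by elim: m => //= m ->; rewrite dtD_realize. Qed.

Lemma expD_realize e a :
  expD_sub1 eta e (realize a) = realize (sym_exp io sT (sym_grad io sX e) a).
Proof.
apply/funext => n; apply/funext => z; rewrite /expD_sub1.
under eq_bigr => m _ do rewrite iter_dtD_realize -realize_scale.
rewrite -realize_sum; congr (_ z); apply: eq_realize => j jn.
(* The fields sum powers up to [n], the symbols only up to the current order [j]; the surplus powers
   vanish at order [j]. *)
rewrite /sym_exp (big_cat_nat (n := j.+1)) //= [X in _ + X](_ : _ = 0) ?addr0 //.
rewrite big_nat big1 // => m /andP[jm _].
by rewrite iter_sym_dtD_eq0 ?mulr0.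
Qed.

Lemma maxwell_step_realize F : maxwell_step P dx dt (fun i => realize (F i)) =
  fun i => realize (sym_step P c io sT sX F i).
Proof.
apply/funext => i; apply/funext => n; apply/funext => z.
rewrite /maxwell_step /sym_step.
rewrite (_ : (fun m => _) = fun m => io (-1) * \sum_k io (invmx (Lambda d P c) i k) *
    sym_exp io sT (sym_grad io sX (evec R k)) (F k) m); last first.
  by apply/funext => m; rewrite rmorphN1 mulN1r.
rewrite realize_scale realize_sum mulN1r; congr (- _); apply: eq_bigr => k _.
by rewrite realize_scale expD_realize.
Qed.

Lemma feq_realize : feq P theta = fun i => realize (sym_feq P io i).
Proof.
apply/funext => i; apply/funext => n; apply/funext => z.
rewrite /realize big_ord_recl /= actC subn0 big1 ?addr0 // => j _.
by rewrite act0.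
Qed.

Lemma maxwell_realize i : maxwell P dx dt theta i = realize (sym_maxwell P c io sT sX i).
Proof.
apply/funext => n; apply/funext => z.
have it m : iter m (maxwell_step P dx dt) (feq P theta)
    = fun k => realize (iter m (sym_step P c io sT sX) (sym_feq P io) k).
  by elim: m => [|m IH] /=; [exact: feq_realize | rewrite IH maxwell_step_realize].
rewrite /maxwell; under eq_bigr => m _ do rewrite it.
rewrite -realize_sum; congr (_ z); apply: eq_realize => j jn.
rewrite /sym_maxwell (big_cat_nat (n := j.+1)) //= [X in _ + X](_ : _ = 0) ?addr0 //.
rewrite big_nat big1 // => m /andP[jm _].
exact: iter_sym_step_eq0.
Qed.

Lemma density_realize : density P dx dt theta = realize (pe P c io sT sX [::] 0).
Proof.
apply/funext => n; apply/funext => z; rewrite /density /pe realize_sum.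
apply: eq_bigr => k _; rewrite maxwell_realize; congr (_ z); apply: eq_realize => j _.
by rewrite /mono big_nil rmorph1 !mul1r.
Qed.

(** The equilibrium part drops out because the first moments of the weights are zero. *)
Lemma dx_momentum_realize i n z : dx_momentum P dx dt theta i n z
  = dx ^+ 2 / dt * realize (pe P c io sT sX [:: i] 0) n z.
Proof.
rewrite /dx_momentum /pe realize_sum.
under eq_bigr => k _ do rewrite mulrBr.
rewrite sumrB [X in _ - X](_ : _ = 0).
  rewrite subr0 mulr_sumr; apply: eq_bigr => k _; rewrite maxwell_realize.
  rewrite (_ : (fun m => _) = fun m => io (evec R k 0 i) * sym_maxwell P c io sT sX k m).
    by rewrite realize_scale; ring.
  by apply/funext => m; rewrite /mono big_seq1 mulr1.
have := @avg_odd R d P [:: i] erefl; rewrite /avg => a0.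
transitivity (dx ^+ 2 / dt * theta n z * \sum_k weight P k * mono [:: i] (evec R k)).
  rewrite mulr_sumr; apply: eq_bigr => k _; rewrite /feq /mono big_seq1; ring.
by rewrite a0 mulr0.
Qed.

End Step.
End Realization.

(** * Accuracy *)

Section Factorization.
Variables (R : realType) (d : nat) (P : params R) (eps c : R).
Hypotheses (d_gt0 : (0 < d)%N) (Padm : admissible d P) (Pcond : conditions d eps P)
  (c_neq0 : c != 0).
Variables (B : comNzRingType) (io : {rmorphism R -> B}) (T : B) (X : 'I_d -> B).

Let h2E : 2^-1 = 2`!%:R^-1 :> R. Proof. by []. Qed.
Let h6E : 6^-1 = 3`!%:R^-1 :> R. Proof. by []. Qed.
Let h24E : 24^-1 = 4`!%:R^-1 :> R. Proof. by []. Qed.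

Lemma power_sum_line (Y : 'I_d -> B) : d = 1%N ->
  X4 Y = X2 Y ^+ 2 /\ forall i, X2 Y = Y i ^+ 2.
Proof.
move=> d1; rewrite /X4 /X2; clear -d1; subst d; rewrite !big_ord1 -exprM.
by split=> // i; rewrite (ord1 i).
Qed.

Lemma second_order_factor :
  pe P c io T X [::] 0 2 = - io (s0 P)^-1 * (T - io eps * X2 X).
Proof.
have [-> _ _ _] := conditions_unified Padm Pcond.
exact: pe_0_0_2.
Qed.

Lemma fourth_order_factor :
  exists K, pe P c io T X [::] 0 4 = K * (T - io eps * X2 X).
Proof.
have e4 := fourth_order_sum Padm Pcond.
rewrite (pe_0_0_4 c_neq0 Padm io T X h2E h6E h24E).
set A4 := a4 _ _ _ _ in e4 *; set G4 := g4 _ _ _ _ _ in e4 *.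
set T4 := t4 _ _ _ _ in e4 *; set S := 2^-1 - _ in e4 *.
(* The quotient of S T^2 + T4 T X2 + ... by T - eps X2 as polynomials in T; the [transitivity] below
   displays the remainder. *)
exists (- io (s0 P)^-1 * (io S * T + io (T4 + eps * S) * X2 X)).
rewrite -[RHS]mulrA; congr (_ * _); apply/eqP; rewrite -subr_eq0; apply/eqP.
transitivity (io (A4 + eps * T4 + eps ^+ 2 * S) * X2 X ^+ 2 + io G4 * X4 X); first by ring.
have [d1|dn1] := eqVneq d 1%N.
  have [-> _] := power_sum_line X d1; rewrite -mulrDl -rmorphD.
  by rewrite -[X in io X](_ : 0 = _) ?rmorph0 ?mul0r // -e4; ring.
have d_gt1 : (1 < d)%N by rewrite ltn_neqAle eq_sym dn1.
have m4 := fourth_order_mixed Padm Pcond d_gt1.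
rewrite -/A4 -/T4 -/S in m4; rewrite m4 rmorph0 mul0r add0r.
(* The coefficient of X4 is the difference between the sum and the mixed identity. *)
have -> : G4 = 0 by move: e4; rewrite -[LHS]subr0 -m4 => <-; ring.
by rewrite rmorph0 mul0r.
Qed.

Lemma third_order_factor i :
  exists K, pe P c io T X [:: i] 0 3 = K * (T - io eps * X2 X).
Proof.
have e3 := third_order_sum Padm Pcond.
rewrite (pe_1_0_3 c_neq0 Padm io T X h2E h6E).
set A3 := a3 _ _ _ in e3 *; set G3 := g3 _ _ _ _ in e3 *; set T3 := t3 _ _ _ in e3 *.
exists (io T3 * X i); apply/eqP; rewrite -subr_eq0; apply/eqP.
transitivity (io (A3 + eps * T3) * X i * X2 X + io G3 * X i ^+ 3).
  by rewrite /tensor1; ring.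
have [d1|dn1] := eqVneq d 1%N.
  have [_ /(_ i) ->] := power_sum_line X d1.
  transitivity (io (A3 + G3 + eps * T3) * X i ^+ 3); first by ring.
  by rewrite e3 rmorph0 mul0r.
have d_gt1 : (1 < d)%N by rewrite ltn_neqAle eq_sym dn1.
have m3 := third_order_mixed Padm Pcond d_gt1.
rewrite -/A3 -/T3 in m3; rewrite m3 rmorph0 !mul0r add0r.
have -> : G3 = 0 by move: e3; rewrite -[LHS]subr0 -m3 => <-; ring.
by rewrite rmorph0 mul0r.
Qed.

End Factorization.

(** * Quotients of formal power series *)

Section SeriesQuotient.
Variable R : realType.
Implicit Types a b : nat -> R.

Lemma size_quot_coefs a b n : size (quot_coefs a b n) = n.
Proof. by elim: n => //= n IH; rewrite size_rcons IH. Qed.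

Definition quot_coef a b n := (quot_coefs a b n.+1)`_n.

Lemma nth_quot_coefs a b n i : (i < n)%N -> (quot_coefs a b n)`_i = quot_coef a b i.
Proof.
elim: n => // n IH; rewrite ltnS leq_eqVlt => /predU1P[->//|iltn] /=.
by rewrite nth_rcons size_quot_coefs iltn IH.
Qed.

Lemma quot_coefE a b n :
  quot_coef a b n = (a n - \sum_(i < n) quot_coef a b i * b (n - i)%N) / b 0%N.
Proof.
rewrite /quot_coef /= nth_rcons size_quot_coefs ltnn eqxx; congr ((_ - _) / _).
by apply: eq_bigr => i _; rewrite nth_quot_coefs.
Qed.

Lemma eq_quot_coef a a' b b' n : (forall m, (m <= n)%N -> a m = a' m) ->
  (forall m, (m <= n)%N -> b m = b' m) -> quot_coef a b n = quot_coef a' b' n.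
Proof.
elim/ltn_ind: n => n IH ha hb; rewrite !quot_coefE ha // hb //; congr ((_ - _) / _).
apply: eq_bigr => i _; rewrite hb ?leq_subr // IH // => m mi.
  by apply: ha; exact: leq_trans mi (ltnW _).
by apply: hb; exact: leq_trans mi (ltnW _).
Qed.

Lemma quot_coef_shift (x : R) a b n :
  quot_coef (fun m => if m is k.+1 then x * a k else 0) b n =
  if n is k.+1 then x * quot_coef a b k else 0.
Proof.
elim/ltn_ind: n => -[|n] IH; rewrite quot_coefE; first by rewrite big_ord0 subr0 mul0r.
rewrite big_ord_recl IH // mul0r add0r quot_coefE mulrA mulrBr mulr_sumr.
by congr ((_ - _) / _); apply: eq_bigr => i _; rewrite lift0 IH ?ltnS // mulrA subSS.
Qed.

End SeriesQuotient.

(** * Heat equation order by order, computed velocity and gradient *)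

Section Accuracy.
Variables (R : realType) (d : nat) (P : params R) (upsilon dx dt : R).
Hypotheses (d_gt0 : (0 < d)%N) (Padm : admissible d P) (u_gt0 : 0 < upsilon)
  (dx_gt0 : 0 < dx) (dt_gt0 : 0 < dt).
Local Notation eta := (dt / dx ^+ 2).
Local Notation c := (dx / dt).
Local Notation eps := (upsilon * dt / dx ^+ 2).
Hypothesis Pcond : conditions d eps P.

Local Notation B := (mpoly.mpoly d.+1 R).
Local Notation io := (@mpoly.mpolyC d.+1 R : {rmorphism R -> B}).
Local Notation T := (sT d dx dt).
Local Notation X := (@sX R d).
Local Notation "'PE' s" := (pe P c io T X s 0) (at level 10, s at level 9).

Let eps_gt0 : 0 < eps. Proof. by rewrite !(divr_gt0, mulr_gt0) ?exprn_gt0. Qed.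
Let c_neq0 : c != 0. Proof. by rewrite gt_eqF // divr_gt0. Qed.
Let eta_neq0 : eta != 0. Proof. by rewrite gt_eqF // divr_gt0 // exprn_gt0. Qed.

Definition heat : B := T - io eps * X2 X.

Lemma act_heat (u : field R d) z : smooth u ->
  act heat u z = eta * (partial_t u z - upsilon * laplacian u z).
Proof.
move=> su; rewrite /heat actD -mulN1r -(rmorphN1 io) /sT /= !mpoly.mul_mpolyC !actZ.
rewrite act_var unlift_none /X2 act_sum.
rewrite (eq_bigr (fun j => partial_x j (partial_x j u) z)) => [|j _].
  rewrite -[pd None u z]/(partial_t u z) -/(laplacian u z).
  by move: (partial_t u z) (laplacian u z) => t l; field; rewrite gt_eqF.
by rewrite expr2 actM // act_var act_var liftK.
Qed.

Variable theta : dxseries R d.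
Hypothesis theta_smooth : smooth_series theta.

Lemma act_zero (K : B) : act K (fun=> 0) = (fun=> 0) :> field R d.
Proof. by apply/funext => z; rewrite /act big1 // => m _; rewrite iter_partial0 mulr0. Qed.

Lemma act_multiple (K : B) u z : smooth u -> act heat u = (fun=> 0) -> act (K * heat) u z = 0.
Proof. by move=> su hu; rewrite actM // hu act_zero. Qed.

Lemma density_coef n z : (n <= 5)%N ->
  density P dx dt theta n z = theta n z
    + (if n is m.+2 then act (PE [::] 2) (theta m) z else 0)
    + (if n is m.+4 then act (PE [::] 4) (theta m) z else 0).
Proof.
move=> n5; rewrite density_realize // /realize.
have z1 : PE [::] 1 = 0 by rewrite (pe_parity c_neq0 Padm io T X erefl erefl erefl erefl).
have z3 : PE [::] 3 = 0 by rewrite (pe_parity c_neq0 Padm io T X erefl erefl erefl erefl).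
have z5 : PE [::] 5 = 0 by rewrite (pe_parity c_neq0 Padm io T X erefl erefl erefl erefl).
have e0 u : act (PE [::] 0) u z = u z by rewrite pe_0_0_0 -(rmorph1 io) actC mul1r.
by case: n n5 => [|[|[|[|[|[|]]]]]] // _;
  rewrite !big_ord_recr big_ord0 /= ?z1 ?z3 ?z5 ?act0 ?e0 ?subn0 ?subnn ?add0r ?addr0.
Qed.

(** Order n + 2 of the density equation is -1/s0 times the heat operator on [theta n] plus a
    fourth-order term containing the heat operator on [theta (n - 2)]. As 1/s0 is nonzero, the
    orders can be solved successively; six orders give four because of the division by dt. *)
Lemma density_heat :
  (forall z, eq_upto 6 (density P dx dt theta) theta z) <->
  (forall n, (n < 4)%N -> act heat (theta n) = fun=> 0).
Proof.
have [K e4] := fourth_order_factor d_gt0 Padm Pcond c_neq0 io T X.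
have e2 := second_order_factor Padm Pcond c_neq0 io T X.
rewrite -/heat in e2 e4.
have n0 : - (s0 P)^-1 != 0.
  by have [h _ _ _] := rates_neq0 Padm; rewrite oppr_eq0 invr_eq0.
have a2E u z : act (PE [::] 2) u z = - (s0 P)^-1 * act heat u z.
  by rewrite e2 -(rmorphN io) /= mpoly.mul_mpolyC actZ.
have a4E n z : act heat (theta n) = (fun=> 0) -> act (PE [::] 4) (theta n) z = 0.
  by move=> h; rewrite e4 act_multiple.
split=> [h|h z n n6]; last first.
  rewrite density_coef //; case: n n6 => [|[|n]] n6; rewrite ?addr0 //.
  rewrite a2E h // mulr0 addr0; case: n n6 => [|[|n]] n6; rewrite ?addr0 //.
  by rewrite a4E ?addr0 // h //; exact: (@leq_trans 2 n.+1 4 n6 isT).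
(* The induction step: order n + 2 involves only one earlier coefficient, so the four cases are then
   settled from [h0] and [h1]. *)
have main n : (n < 4)%N -> (forall m, (m.+2 = n)%N -> act heat (theta m) = fun=> 0) ->
    act heat (theta n) = fun=> 0.
  move=> n4 hm; apply/funext => z.
  have e0 : (if n is m.+2 then act (PE [::] 4) (theta m) z else 0) = 0.
    by case: n {n4} hm => [|[|m]] hm //; rewrite a4E // hm.
  have := h z n.+2 n4; rewrite density_coef //= e0 addr0 a2E => /eqP.
  rewrite -subr_eq0 addrAC subrr add0r mulf_eq0 (negPf n0) /=.
  by move/eqP.
have h0 : act heat (theta 0%N) = fun=> 0 by apply: main.
have h1 : act heat (theta 1%N) = fun=> 0 by apply: main.
case=> [|[|[|[|]]]] // _; apply: main => // m []; [move=> ->; exact: h0|move=> ->; exact: h1].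
Qed.

Lemma heat_eq n : act heat (theta n) = (fun=> 0) <->
  forall z, partial_t (theta n) z = upsilon * laplacian (theta n) z.
Proof.
split=> h; last by apply/funext => z; rewrite act_heat // h subrr mulr0.
move=> z; have := congr1 (fun f : field R d => f z) h; rewrite act_heat //= => /eqP.
by rewrite mulf_eq0 (negPf eta_neq0) subr_eq0 => /eqP.
Qed.

Local Notation mom := (- (dx ^+ 2 / dt * ((s1 P)^-1 * c2 d P))).

Lemma dx_momentum_coef i n z : (n < 5)%N ->
  (forall m, (m < 4)%N -> act heat (theta m) = fun=> 0) ->
  dx_momentum P dx dt theta i n z
    = if n is m.+1 then mom * partial_x i (theta m) z else 0.
Proof.
move=> n5 h; rewrite dx_momentum_realize // /realize.
have z0 : PE [:: i] 0 = 0 by rewrite (pe_parity c_neq0 Padm io T X erefl erefl erefl erefl).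
have z2 : PE [:: i] 2 = 0 by rewrite (pe_parity c_neq0 Padm io T X erefl erefl erefl erefl).
have z4 : PE [:: i] 4 = 0 by rewrite (pe_parity c_neq0 Padm io T X erefl erefl erefl erefl).
have [K e3] := third_order_factor d_gt0 Padm Pcond c_neq0 io T X i.
have a3E m : (m < 4)%N -> act (PE [:: i] 3) (theta m) z = 0.
  by move=> m4; rewrite e3 act_multiple // h.
have a1E u : act (PE [:: i] 1) u z = - ((s1 P)^-1 * c2 d P) * partial_x i u z.
  by rewrite (pe_1_0_1 c_neq0 Padm) -(rmorphN io) /= mpoly.mul_mpolyC actZ act_var liftK.
case: n n5 => [|[|[|[|[|]]]]] // _;
  rewrite !big_ord_recr big_ord0 /= ?z0 ?z2 ?z4 ?act0 ?a1E ?a3E //;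
  rewrite ?addr0 ?add0r ?mulr0 //; by rewrite mulrA mulrN mulNr.
Qed.

(** (2 - s1) / s1 = 2 (1/s1 - 1/2) and eps = (1/s1 - 1/2) [c2]: this is why the velocity formula
    carries the factor 2 - s1. *)
Lemma mom_velocity : (2 - s1 P) * mom = - 2 * upsilon.
Proof.
have [e _ _ _] := conditions_unified Padm Pcond; have [_ n1 _ _] := rates_neq0 Padm.
have nx : dx != 0 by rewrite gt_eqF.
have nt : dt != 0 by rewrite gt_eqF.
have -> : upsilon = dx ^+ 2 / dt * eps by field; rewrite nx nt.
by rewrite e; field; rewrite n1 nt.
Qed.

Lemma mom_gradient : - (s1 P / (dt * cs2 d P c)) * mom = 1.
Proof.
have [_ n1 _ _] := rates_neq0 Padm; have nk := c2_neq0 Padm Pcond eps_gt0.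
have nx : dx != 0 by rewrite gt_eqF.
have nt : dt != 0 by rewrite gt_eqF.
rewrite /cs2 -/(c2 d P); move: (c2 d P) nk => k nk.
by field; rewrite n1 nx nt nk.
Qed.

End Accuracy.

Theorem theorem2 (R : realType) (d : nat) (d_gt0 : (0 < d)%N) :
  (* (i) *)
  (forall (upsilon eta dx : R) (P : params R),
     0 < upsilon -> 0 < eta -> 0 < dx -> admissible d P ->
     let dt := eta * dx ^+ 2 in
     let eps := upsilon * dt / dx ^+ 2 in
     conditions d eps P -> accurate_in_space d 4 upsilon P dx dt) /\
  (* (ii) *)
  (forall eps : R, 0 < eps ->
     let s1 := 2 / (6 * eps + 1) in
     let s2 := 24 * eps / (6 * eps + 1) ^+ 2 in
     let s22 := 4 / (6 * eps + 3) in
     (d = 1%N ->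
        [/\ 0 < s1 < 2, 0 < s2 < 2 & system1 eps (1 / 6) s1 s2]) /\
     ((1 < d)%N ->
        [/\ 0 < s1 < 2, 0 < s2 < 2, 0 < s22 < 2
          & systemd d eps (1 / 6 - (d%:R - 1) * eps / 3) (eps / 6) s1 s2 s22])) /\
  (* (iii) *)
  (forall (upsilon eta dx : R) (P : params R),
     0 < upsilon -> 0 < eta -> 0 < dx -> admissible d P ->
     let dt := eta * dx ^+ 2 in
     let eps := upsilon * dt / dx ^+ 2 in
     conditions d eps P -> gradient_accurate d 4 upsilon P dx dt).
Proof.
split; last split.
- move=> upsilon eta dx P u0 eta0 dx0 Padm dt eps Pcond.
  have dt0 : 0 < dt by rewrite mulr_gt0 // exprn_gt0.
  have dens theta ts := @density_heat R d P upsilon dx dt d_gt0 Padm dx0 dt0 Pcond theta ts.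
  have heatE theta ts n := @heat_eq R d upsilon dx dt dx0 dt0 theta ts n.
  split=> [theta ts|theta ts /(dens _ ts) h i z t0 n n5].
    split=> [/(dens _ ts) h z n n4|h].
      exact: (proj1 (heatE _ ts n) (h n n4)).
    by apply/(dens _ ts) => n n4; apply/(heatE _ ts n) => z; exact: h.
  (* The n-th coefficient of a quotient sees only coefficients up to [n], so the density may be
     replaced by [theta] in the denominator. *)
  have eqd : forall m, (m <= n)%N -> density P dx dt theta m z = theta m z.
    by move=> m mn; have /(dens _ ts) := h; apply; apply: leq_ltn_trans mn (leqW n5).
  have eqm : forall m, (m <= n)%N -> dx_momentum P dx dt theta i m z =
      if m is k.+1 then - (dx ^+ 2 / dt * ((s1 P)^-1 * c2 d P)) * partial_x i (theta k) z else 0.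
    move=> m mn; apply: (dx_momentum_coef d_gt0 Padm dx0 dt0 Pcond ts _ _ _ h).
    exact: leq_ltn_trans mn n5.
  rewrite /series_div -/(quot_coef _ _ _) (eq_quot_coef eqm eqd) quot_coef_shift.
  case: n {n5 eqd eqm} => [|n] /=; first by rewrite mulr0.
  by rewrite mulrA (mom_velocity Padm dx0 dt0 Pcond).
- move=> eps e0 S1 S2 S22; have [h1 h2 h22] := explicit_admissible e0.
  split=> _; split=> //; [exact: explicit_system1 | exact: explicit_systemd].
move=> upsilon eta dx P u0 eta0 dx0 Padm dt eps Pcond theta ts heq i z n n5.
have dt0 : 0 < dt by rewrite mulr_gt0 // exprn_gt0.
(* An exact solution is the series with vanishing higher coefficients; each coefficient solves the
   heat equation, so the momentum expansion applies. *)
have cs : smooth_series (const_series theta).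
  by case=> [|m]; [exact: ts | exact: smooth0].
rewrite (dx_momentum_coef d_gt0 Padm dx0 dt0 Pcond cs _ _ n5); last first.
  case=> [|m] _; first by apply/(heat_eq upsilon dx0 dt0 cs 0) => w; exact: heq.
  exact: act_zero.
case: n n5 => [|n] n5 /=; first by rewrite mulr0.
rewrite mulrA (mom_gradient Padm u0 dx0 dt0 Pcond) mul1r.
by case: n n5 => [|n] n5 //=; rewrite /partial_x derive_cst.
Qed.
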